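(* Let $\overline\theta$ be a constant with $\frac12\vee\underline\theta<\overline\theta<1$. Assume: (a) there exist a probability measure $\nu$ on $[\underline\theta,\overline\theta]$ and positive constants $\lambda_1,\lambda_2$ such that for all $\varphi,\phi\in\mathscr C([\underline\theta,1];\mathbb R^n)$ and $t\ge0$, $$2\langle\varphi(1)-\phi(1),f(\varphi,t)-f(\phi,t)\rangle+|g(\varphi,t)-g(\phi,t)|^2\le-\lambda_1|\varphi(1)-\phi(1)|^2+\lambda_2\int_{\underline\theta}^{\overline\theta}|\varphi(\theta)-\phi(\theta)|^2\,d\nu(\theta);$$ (b) there exist a probability measure $\nu$ on $[\underline\theta,\overline\theta]$ and positive constants $\lambda_3,\lambda_4$ such that for all $\varphi,\phi\in\mathscr C([\underline\theta,1];\mathbb R^n)$ and $t\ge0$, $$|f(\varphi,t)-f(\phi,t)|^2\vee|g(\varphi,t)-g(\phi,t)|^2\le\lambda_3|\varphi(1)-\phi(1)|^2+\lambda_4\int_{\underline\theta}^{\overline\theta}|\varphi(\theta)-\phi(\theta)|^2\,d\nu(\theta).$$ Suppose that $\lambda_1-2\lambda_2\big(\lfloor\frac1{\underline\theta}\rfloor+1\big)>0$, and let $\zeta^*$ be the unique positive root $\zeta$ of the equation $$\lambda_1-\zeta=2\lambda_2\Big(\Big\lfloor\frac1{\underline\theta}\Big\rfloor+1\Big)\underline\theta^{-\zeta}.$$ Then for any $\varepsilon\in(0,\frac{\zeta^*}2)$ there exists a sufficiently small $\Delta^*\in(0,1)$ such that for every step size $\Delta\in(0,\Delta^* )$ satisfying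 $$\Big[\lambda_2\Big(\Big\lfloor\frac1{\underline\theta}\Big\rfloor+1\Big)\underline\theta^{-\zeta^*-1}+\lambda_4\Big(\Big\lfloor\frac1{\underline\theta}\Big\rfloor+1\Big)\underline\theta^{-\zeta^*-1}\Delta\Big]\Delta<\frac12,$$ the Euler-Maruyama approximate solution $y(k)$ with step size $\Delta$ satisfies $$\limsup_{k\to\infty}\frac{\log|y(k)|}{\log|(k+1)\Delta|}\le-\frac{\zeta^*}2+\varepsilon\quad\text{almost surely}$$ and $$\limsup_{k\to\infty}\frac{\log\mathbb E\big[|y(k)|^2\big]}{\log|(k+1)\Delta|}\le-\zeta^*+2\varepsilon .$$
   Context: $(\Omega,\mathscr F,\{\mathscr F_t\}_{t\ge0},P)$ is a complete filtered probability space satisfying the usual conditions, carrying a standard $d$-dimensional Brownian motion $B$. $|\cdot|$ is the Euclidean norm for vectors and $|A|=\sqrt{\mathrm{Tr}(AA^T)}$ for matrices; $\langle\cdot,\cdot\rangle$ is the Euclidean inner product; $a\vee b=\max(a,b)$; $\lfloor a\rfloor$ is the integer part; $\log0=-\infty$. Fix $0<\underline\theta<1$. $\mathscr C([\underline\theta,1];\mathbb R^n)$ is the space of continuous functions $\varphi:[\underline\theta,1]\to\mathbb R^n$ with the supremum norm. The coefficients are $f:\mathscr C([\underline\theta,1];\mathbb R^n)\times[0,\infty)\to\mathbb R^n$ and $g:\mathscr C([\underline\theta,1];\mathbb R^n)\times[0,\infty)\to\mathbb R^{n\times d}$, with $f(0,t)=g(0,t)=0$ for all $t\ge0$; $x_0\in\mathbb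 R^n$. The underlying equation is $dx(t)=f(x_t,t)\,dt+g(x_t,t)\,dB(t)$, $x(0)=x_0$, with $x_t(\theta)=x(\theta t)$, $\underline\theta\le\theta\le1$. Euler-Maruyama scheme with step size $\Delta\in(0,1)$: set $y(0)=x_0$ and, for $k=0,1,2,\dots$, $$y(k+1)=y(k)+f(y_k,k\Delta)\Delta+g(y_k,k\Delta)\Delta B(k),\qquad \Delta B(k)=B((k+1)\Delta)-B(k\Delta).$$ Here, for $k\ge1$, $y_k(u)$ is defined for $k\underline\theta\Delta\le u\le k\Delta$ by linear interpolation: $$y_k(u)=\frac{(j+1)\Delta-u}{\Delta}\,y(j)+\frac{u-j\Delta}{\Delta}\,y(j+1)\quad\text{for } j\Delta\le u\le(j+1)\Delta,\ \ \lfloor k\underline\theta\rfloor\le j\le k-1,$$ and $y_0\equiv x_0$; when $y_k$ is inserted in $f$ or $g$ it is regarded as the element $\theta\mapsto y_k(\theta k\Delta)$ of $\mathscr C([\underline\theta,1];\mathbb R^n)$. *)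

(* Defs.v *)
From HB Require Import structures.
From mathcomp Require Import all_boot all_order all_algebra.
From mathcomp Require Import all_classical all_reals all_analysis.
From mathcomp Require Import ring lra.

Set Implicit Arguments.
Unset Strict Implicit.
Unset Printing Implicit Defensive.

Import Order.TTheory GRing.Theory Num.Theory.
Import numFieldNormedType.Exports.

#[global] Open Scope classical_set_scope.
#[global] Open Scope ring_scope.

(* Trace norm; the norm that the library puts on matrices is the sup norm.
   On column vectors this is the Euclidean norm. *)
Definition enorm (R : realType) (m n : nat) (M : 'M[R]_(m, n)) : R :=
  Num.sqrt (\tr (M *m M^T)).

Definition dotv (R : realType) (n : nat) (u v : 'cV[R]_n) : R :=
  \sum_(i < n) u i ord0 * v i ord0.

Definition Cseg (R : realType) (a : R) (n : nat) : Type :=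
  continuousType (set_type `[a, 1]) 'cV[R]_n.

(* The value at t of an element of C([a,1]; R^n), with junk value 0 when t
   lies outside [a,1]. *)
Definition ev (R : realType) (a : R) (n : nat) (phi : Cseg a n) (t : R) :
  'cV[R]_n := valL_ 0 (phi : set_type `[a, 1] -> 'cV[R]_n) t.

Definition Cseg0 (R : realType) (a : R) (n : nat) : Cseg a n :=
  mkcts (fun x => @cst_continuous (set_type `[a, 1]) 'cV[R]_n 0 x).

(* For u in [jD, (j+1)D] this is ((j+1)D - u)/D * y(j) + (u - jD)/D * y(j+1).
   At a node u = jD the two admissible indices give the same value y(j); the
   integer part selects one of them. In particular on [0, kD] the result only
   depends on y(0), ..., y(k). *)
Definition linterp (R : realType) (n : nat) (D : R) (y : nat -> 'cV[R]_n)
    (u : R) : 'cV[R]_n :=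
  let j := Num.truncn (u / D) in
  ((j.+1%:R * D - u) / D) *: y j + ((u - j%:R * D) / D) *: y j.+1.

Section linterp_continuous.
Variables (R : realType) (n : nat) (y : nat -> 'cV[R]_n).

Let hat (j : nat) (s : R) : R :=
  Num.min (if j == 0%N then s else Num.max (s - j%:R) 0) 1.

Let hat_continuous j : continuous (hat j).
Proof.
move=> s; apply: (@continuous_min _ R _ _ s); last exact: cst_continuous.
case: (j == 0%N); first exact: id.
apply: (@continuous_max _ R _ _ s); last exact: cst_continuous.
by apply: cvgB; [exact: id|exact: cst_continuous].
Qed.

Let interp (s : R) : 'cV[R]_n :=
  let j := Num.truncn s in
  (j.+1%:R - s) *: y j + (s - j%:R) *: y j.+1.

Let interpE (N : nat) (s : R) : s < N.+1%:R ->
  interp s = y 0%N + \sum_(j < N.+1) hat j s *: (y j.+1 - y j).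
Proof.
move=> sN; rewrite /interp; set m := Num.truncn s.
have mN : (m < N.+1)%N by rewrite ltnS /m truncn_le_nat.
have sm : s < m.+1%:R by rewrite /m truncnS_gt.
have ms : m = 0%N \/ m%:R <= s.
  have [s0|s0] := leP 0 s; first by right; rewrite /m truncn_le.
  by left; rewrite /m truncn_floor leNgt s0.
rewrite -(big_mkord xpredT (fun j => hat j s *: (y j.+1 - y j))).
rewrite (@big_cat_nat _ _ _ m) //=; last exact: ltnW.
rewrite [X in _ + (_ + X)]big_ltn//.
rewrite [X in _ + (_ + (_ + X))]big1_seq ?addr0; last first.
  move=> j /andP[_]; rewrite mem_index_iota => /andP[mj _]; rewrite /hat; case: j mj => // j mj /=.
  rewrite max_r ?min_l ?scale0r// subr_le0 (le_trans (ltW sm))//.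
  by rewrite ler_nat.
have -> : \sum_(0 <= j < m) hat j s *: (y j.+1 - y j) = y m - y 0%N.
  rewrite -telescope_sumr//; apply: eq_big_nat => j /andP[_ jm].
  suff -> : hat j s = 1 by rewrite scale1r.
  case: ms => [m0|ms]; first by rewrite m0 in jm.
  have js : j%:R + 1 <= s.
    by apply: le_trans ms; rewrite natr1 ler_nat.
  rewrite /hat; case: eqP => [j0|_]; first by rewrite min_r//; move: js; rewrite j0; lra.
  by rewrite min_r// le_max; apply/orP; left; lra.
have -> : hat m s = s - m%:R.
  have sm' : s < m%:R + 1 by rewrite natr1.
  rewrite /hat; case: eqP => [m0|m0].
    by move: sm'; rewrite m0 subr0 => sm'; rewrite min_l//; lra.
  case: ms => // ms.
  by rewrite max_l ?min_l//; lra.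
rewrite -natr1.
apply/matrixP => i k; rewrite !mxE; ring.
Qed.

Let interp_continuous : continuous interp.
Proof.
move=> s.
have sN : s < (Num.truncn s).+2%:R.
  by apply: (lt_trans (truncnS_gt s)); rewrite ltr_nat.
set N := (Num.truncn s).+1 in sN.
have h : \forall t \near s,
    y 0%N + \sum_(j < N.+1) hat j t *: (y j.+1 - y j) = interp t.
  near=> t; rewrite -interpE//; near: t.
  exact: lt_nbhsl.
rewrite /continuous_at (interpE sN).
apply: cvg_trans.
  apply: near_eq_cvg; exact: h.
apply: cvgD; first exact: cst_continuous.
apply: cvg_big; first exact: add_continuous.
move=> j _; apply: cvgZr_tmp; exact: hat_continuous.
Unshelve. all: by end_near.
Qed.

Lemma linterp_continuous (D c : R) :
  continuous (fun t : R => linterp D y (t * c * D)).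
Proof.
have [->|D0] := eqVneq D 0.
  rewrite (_ : (fun _ => _) = (fun=> 0)); first exact: cst_continuous.
  by apply/funext => t; rewrite /linterp invr0 !mulr0 !scale0r addr0.
rewrite (_ : (fun _ => _) = interp \o (fun t => t * c)).
  move=> t; apply: continuous_comp; last exact: interp_continuous.
  by apply: cvgMr_tmp; exact: id.
apply/funext => t; rewrite /linterp /interp /= mulfK//.
by rewrite -!mulrBl !mulfK.
Qed.

End linterp_continuous.

Lemma sigL_linterp_continuous (R : realType) (a : R) (n : nat) (D : R)
  (y : nat -> 'cV[R]_n) (k : nat) :
  continuous (sigL `[a, 1] (fun t : R => linterp D y (t * k%:R * D))).
Proof.
apply/subspace_sigL_continuousP; apply: continuous_subspaceT.
exact: linterp_continuous.
Qed.

(* y_k, regarded as the element t |-> y_k(t k D) of C([a,1]; R^n). *)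
Definition EMseg (R : realType) (a : R) (n : nat) (D : R)
    (y : nat -> 'cV[R]_n) (k : nat) : Cseg a n :=
  mkcts (@sigL_linterp_continuous R a n D y k).

Definition EM_scheme (R : realType) (Omega : Type) (a : R) (n d : nat)
    (f : Cseg a n -> R -> 'cV[R]_n) (g : Cseg a n -> R -> 'M[R]_(n, d))
    (x0 : 'cV[R]_n) (B : R -> Omega -> 'cV[R]_d) (D : R)
    (y : nat -> Omega -> 'cV[R]_n) : Prop :=
  forall w : Omega,
    y 0%N w = x0 /\
    forall k : nat,
      y k.+1 w = y k w + D *: f (EMseg a D (y^~ w) k) (k%:R * D)
        + g (EMseg a D (y^~ w) k) (k%:R * D)
            *m (B (k.+1%:R * D) w - B (k%:R * D) w).

(* Time is real; only the values of a filtration or of a process at times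
   t >= 0 are ever constrained or used. *)
Record usual_filtration (R : realType) (disp : measure_display)
    (Omega : measurableType disp) (P : probability Omega R)
    (Fil : R -> set (set Omega)) : Prop := UsualFiltration {
  filt_sigma : forall t : R, 0 <= t -> sigma_algebra setT (Fil t) ;
  filt_meas : forall t : R, 0 <= t -> Fil t `<=` measurable ;
  filt_mono : forall s t : R, 0 <= s -> s <= t -> Fil s `<=` Fil t ;
  filt_right_cont : forall t : R, 0 <= t ->
    \bigcap_(s in [set s | t < s]) Fil s `<=` Fil t ;
  filt_complete : P.-negligible `<=` Fil 0 }.

Definition sigma_of_vector (R : realType) (Omega : Type) (d : nat)
    (X : Omega -> 'cV[R]_d) : set (set Omega) :=
  <<s [set E | exists (i : 'I_d) (A : set (measurableTypeR R)),
         measurable A /\ E = (fun w => X w i ord0) @^-1` A] >>.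

(* The increment over [s, t] has law N(0, (t - s) I_d), i.e. its components
   are independent with law N(0, t - s); normal_prob takes the standard
   deviation as its second parameter. *)
Record brownian_motion (R : realType) (disp : measure_display)
    (Omega : measurableType disp) (P : probability Omega R)
    (Fil : R -> set (set Omega)) (d : nat) (B : R -> Omega -> 'cV[R]_d) :
    Prop := BrownianMotion {
  bm_adapted : forall t : R, 0 <= t -> sigma_of_vector (B t) `<=` Fil t ;
  bm_start : {ae P, forall w, B 0 w = 0} ;
  bm_gaussian : forall (s t : R) (A : 'I_d -> set (measurableTypeR R)),
    0 <= s -> s < t -> (forall i, measurable (A i)) ->
    P [set w | forall i, A i ((B t w - B s w) i ord0)] =
    (\prod_(i < d) normal_prob 0 (Num.sqrt (t - s)) (A i))%E ;
  bm_indep : forall (s t : R) (E F : set Omega), 0 <= s -> s < t ->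
    Fil s E -> sigma_of_vector (fun w => B t w - B s w) F ->
    P (E `&` F) = (P E * P F)%E ;
  bm_continuous : {ae P, forall w,
    {within `[0, +oo[, continuous (fun t : R => B t w)}} }.

(* Main.v *)
Require Import Defs.
From HB Require Import structures.
From mathcomp Require Import all_boot all_order all_algebra.
From mathcomp Require Import all_classical all_reals all_analysis.
From mathcomp Require Import measurable_realfun ring lra.
Import Order.TTheory GRing.Theory Num.Theory.
Import numFieldNormedType.Exports.

(** Write U_k = |y(k)|^2 and expand the square in one step of the scheme. The
    Brownian increment is independent of the past, centred, with covariance at
    most D times the identity (lemma [noise_step]), so on every event A known
    at time kD the dissipativity and Lipschitz hypotheses give
      E[1_A U_(k+1)] <= q E[1_A U_k] + sum_(j <= k) b_kj E[1_A U_j],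
    where q = 1 - D l1 + D^2 l3. The delay enters only through the numbers
    b_kj: convexity of the square along the interpolated path replaces the
    integral of |y_k|^2 over the delay measure by a deterministic combination
    of U_0, ..., U_k, whose weights are integrals of tent functions
    ([integral_linterp]). Since the points k u, for u >= th, are th-separated,
    each U_j is used at most L = 2 (floor (1 / th) + 1) times, and only at
    times k <= (j + 1) / th ([delay_coef_column]).

    Weigh time k by w_k = (k + 1)^zs. The total weighted use of U_j over all
    the future is then at most
      gamma_j = (D l2 + D^2 l4) L ((j + 1) / th + 2)^zs,
    and the process
      w_k U_k + sum_(j < k) gamma_j U_j - (what the delay has consumed so far)
    dominates w_k U_k and is a supermartingale from some time K on, provided
    w_(k+1) q + gamma_k <= w_k for k >= K ([lyapunov_step], [lyapunov_ge]).
    Divided by w_k, the left side converges to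
    q + (D l2 + D^2 l4) L th^(-zs), and the equation that defines zs turns the
    requirement that this limit be less than 1 into D (l3 + l4 L th^(-zs)) < zs:
    it holds for all small D ([weights_eventually]).

    A nonnegative supermartingale has bounded means and, by the maximal
    inequality, almost surely bounded paths ([supermartingale_bounded_ae]).
    Hence w_k E U_k is bounded and w_k U_k is almost surely bounded
    ([EM_weighted_bounds]); taking logarithms gives the rates -zs for the mean
    square and -zs / 2 for almost every path, and e absorbs the constants
    ([limn_esup_rate]). *)

Set Implicit Arguments.
Unset Strict Implicit.
Unset Printing Implicit Defensive.

(** * Euclidean norms and expectations *)

Section norms.
Variable R : realType.

Lemma enorm2E m n (M : 'M[R]_(m, n)) :
  enorm M ^+ 2 = \sum_i \sum_j M i j ^+ 2.
Proof.
have E : \tr (M *m M^T) = \sum_i \sum_j M i j ^+ 2.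
  by apply: eq_bigr => i _; rewrite mxE; apply: eq_bigr => j _; rewrite !mxE.
rewrite /enorm sqr_sqrtr// E.
by apply: sumr_ge0 => i _; apply: sumr_ge0 => j _; exact: sqr_ge0.
Qed.

Lemma enorm2_ge0 m n (M : 'M[R]_(m, n)) : 0 <= enorm M ^+ 2.
Proof. exact: sqr_ge0. Qed.

Lemma entry_le_enorm2 m n (M : 'M[R]_(m, n)) i j : M i j ^+ 2 <= enorm M ^+ 2.
Proof.
rewrite enorm2E (bigD1 i)//= (bigD1 j)//= -addrA lerDl addr_ge0//.
  by apply: sumr_ge0 => k _; exact: sqr_ge0.
by apply: sumr_ge0 => k _; apply: sumr_ge0 => l _; exact: sqr_ge0.
Qed.

Lemma enorm20 m n : enorm (0 : 'M[R]_(m, n)) ^+ 2 = 0.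
Proof.
rewrite enorm2E big1// => i _; rewrite big1// => j _.
by rewrite mxE expr0n.
Qed.

Lemma enorm2Z m n (c : R) (M : 'M[R]_(m, n)) :
  enorm (c *: M) ^+ 2 = c ^+ 2 * enorm M ^+ 2.
Proof.
rewrite !enorm2E mulr_sumr; apply: eq_bigr => i _; rewrite mulr_sumr.
by apply: eq_bigr => j _; rewrite mxE exprMn.
Qed.

Lemma enorm2D n (u v : 'cV[R]_n) :
  enorm (u + v) ^+ 2 = enorm u ^+ 2 + 2 * dotv u v + enorm v ^+ 2.
Proof.
rewrite !enorm2E /dotv mulr_sumr -!big_split/=; apply: eq_bigr => i _.
by rewrite !big_ord1 mxE; ring.
Qed.

Lemma dotvZr n c (u v : 'cV[R]_n) : dotv u (c *: v) = c * dotv u v.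
Proof.
by rewrite /dotv mulr_sumr; apply: eq_bigr => i _; rewrite mxE; ring.
Qed.

(** The difference of the two sides is r (1 - r) |u - v|^2. *)
Lemma enorm2_convex n (u v : 'cV[R]_n) (r : R) : 0 <= r <= 1 ->
  enorm ((1 - r) *: u + r *: v) ^+ 2
  <= (1 - r) * enorm u ^+ 2 + r * enorm v ^+ 2.
Proof.
move=> /andP[r0 r1]; rewrite !enorm2E !mulr_sumr -big_split/=.
apply: ler_sum => i _; rewrite !big_ord1 !mxE.
have : 0 <= r * (1 - r) * (u i ord0 - v i ord0) ^+ 2.
  by apply: mulr_ge0; [apply: mulr_ge0; rewrite ?subr_ge0|exact: sqr_ge0].
move=> h; rewrite -subr_ge0; apply: (le_trans h); rewrite le_eqVlt.
by apply/orP; left; apply/eqP; ring.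
Qed.

End norms.

Section mean.
Context (R : realType) (disp : measure_display) (Omega : measurableType disp).
Variable P : probability Omega R.

Implicit Types X Y : Omega -> R.

(** Integrability and the value of the expectation are kept together so that
    linear computations with expectations chain without side conditions. *)
Definition has_mean (X : Omega -> R) (m : R) :=
  P.-integrable setT (EFin \o X) /\ \int[P]_w X w = m.

Lemma has_mean_intro X : P.-integrable setT (EFin \o X) ->
  has_mean X (\int[P]_w X w).
Proof. by []. Qed.

Lemma has_mean_ext X Y m : (forall w, X w = Y w) -> has_mean X m -> has_mean Y m.
Proof. by move=> /funext ->. Qed.

Lemma has_mean_eq X m m' : m = m' -> has_mean X m -> has_mean X m'.
Proof. by move=> ->. Qed.

Lemma has_meanD X Y m m' : has_mean X m -> has_mean Y m' ->
  has_mean (fun w => X w + Y w) (m + m').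
Proof.
move=> [iX <-] [iY <-]; split; last by rewrite RintegralD.
by have := integrableD measurableT iX iY; apply: eq_integrable.
Qed.

Lemma has_meanZ c X m : has_mean X m -> has_mean (fun w => c * X w) (c * m).
Proof.
move=> [iX <-]; split; last by rewrite RintegralZl.
by have := integrableZl measurableT c iX; apply: eq_integrable.
Qed.

Lemma has_meanB X Y m m' : has_mean X m -> has_mean Y m' ->
  has_mean (fun w => X w - Y w) (m - m').
Proof.
move=> hX /(has_meanZ (-1)) hY.
apply: has_mean_eq (has_mean_ext _ (has_meanD hX hY)).
  by rewrite mulN1r.
by move=> w; rewrite mulN1r.
Qed.

Lemma has_mean0 : has_mean (fun=> 0) 0.
Proof.
split; first exact: integrable0.
by rewrite Rintegral_cst// mul0r.
Qed.

Lemma has_mean_cst c : has_mean (fun=> c) c.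
Proof.
split; first exact: finite_measure_integrable_cst.
by rewrite Rintegral_cst//= probability_setT mulr1.
Qed.

Lemma has_mean_sum (I : Type) (r : seq I) (p : pred I) (X : I -> Omega -> R)
    (m : I -> R) : (forall i, has_mean (X i) (m i)) ->
  has_mean (fun w => \sum_(i <- r | p i) X i w) (\sum_(i <- r | p i) m i).
Proof.
move=> h; elim: r => [|i r IH].
  rewrite big_nil; apply: has_mean_ext has_mean0 => w.
  by rewrite big_nil.
rewrite big_cons; case: ifP => pi.
  by apply: has_mean_ext (has_meanD (h i) IH) => w; rewrite big_cons pi.
by apply: has_mean_ext IH => w; rewrite big_cons pi.
Qed.

Lemma has_mean_le X Y m m' : has_mean X m -> has_mean Y m' ->
  (forall w, X w <= Y w) -> m <= m'.
Proof. by move=> [iX <-] [iY <-] XY; apply: le_Rintegral. Qed.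

Lemma has_mean_uniq X m m' : has_mean X m -> has_mean X m' -> m = m'.
Proof. by move=> [_ <-] [_ <-]. Qed.

Lemma integrable_dom X Y : measurable_fun setT X ->
  P.-integrable setT (EFin \o Y) -> (forall w, `|X w| <= Y w) ->
  P.-integrable setT (EFin \o X).
Proof.
move=> mX iY XY; apply: le_integrable iY => //.
  exact/measurable_EFinP.
move=> w _ /=; rewrite lee_fin (le_trans (XY w))// ler_norm//.
Qed.

(** By the arithmetic-geometric mean inequality, |XY| <= X^2 + Y^2. *)
Lemma integrable_mul X Y : measurable_fun setT X -> measurable_fun setT Y ->
  P.-integrable setT (EFin \o (fun w => X w ^+ 2)) ->
  P.-integrable setT (EFin \o (fun w => Y w ^+ 2)) ->
  P.-integrable setT (EFin \o (fun w => X w * Y w)).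
Proof.
move=> mX mY iX iY.
have [iXY _] := has_meanD (has_mean_intro iX) (has_mean_intro iY).
apply: integrable_dom iXY _; first exact: measurable_funM.
move=> w; rewrite normrM -(real_normK (num_real (X w))).
rewrite -(real_normK (num_real (Y w))).
have := sqr_ge0 (`|X w| - `|Y w|); have := normr_ge0 (X w).
have := normr_ge0 (Y w); nra.
Qed.

Lemma integrable_sqr X : measurable_fun setT X ->
  P.-integrable setT (EFin \o (fun w => X w ^+ 2)) ->
  P.-integrable setT (EFin \o X).
Proof.
move=> mX iX.
have [iX1 _] := has_meanD (has_mean_intro iX) (has_mean_cst 1).
apply: integrable_dom iX1 _ => // w.
rewrite -(real_normK (num_real (X w))).
have := sqr_ge0 (`|X w| - 1); nra.
Qed.

Lemma measurable_indicM (A : set Omega) X : measurable A ->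
  measurable_fun setT X -> measurable_fun setT (fun w => \1_A w * X w).
Proof. by move=> mA mX; apply: measurable_funM => //; exact: measurable_indic. Qed.

Lemma integrable_indicM (A : set Omega) X : measurable A ->
  P.-integrable setT (EFin \o X) ->
  P.-integrable setT (EFin \o (fun w => \1_A w * X w)).
Proof.
move=> mA iX.
apply: le_integrable (iX) => //.
  apply/measurable_EFinP; apply: measurable_indicM => //.
  by apply/measurable_EFinP; exact: measurable_int iX.
move=> w _ /=; rewrite lee_fin normrM ger0_norm ?indicE//.
by case: (_ \in _); rewrite ?mul1r ?mul0r.
Qed.

End mean.

Section independence.
Context (R : realType) (disp : measure_display) (Omega : measurableType disp).
Variable P : probability Omega R.

(** The hypothesis says that the law of (X, Y) agrees with the product of the two
    laws on rectangles. Finite measures that agree on rectangles are equal, so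
    Fubini computes the expectation of the product. *)
Lemma independent_mean (X Y : Omega -> R) (a b : R) :
  measurable_fun setT X -> measurable_fun setT Y ->
  (forall A B : set R, measurable A -> measurable B ->
    P ((X @^-1` A) `&` (Y @^-1` B)) = (P (X @^-1` A) * P (Y @^-1` B))%E) ->
  has_mean P X a -> has_mean P Y b ->
  has_mean P (fun w => X w * Y w) (a * b).
Proof.
move=> mX mY XY [iX <-] [iY <-].
pose X1 : {mfun Omega >-> R} := mfun_Sub (mem_set mX).
pose Y1 : {mfun Omega >-> R} := mfun_Sub (mem_set mY).
have mZ : measurable_fun setT (fun w => (X w, Y w) : R * R).
  exact: measurable_fun_pair.
pose Z1 : {mfun Omega >-> (R * R)%type} := mfun_Sub (mem_set mZ).
pose dX := distribution P X1; pose dY := distribution P Y1.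
pose dZ := distribution P Z1.
have dE S : measurable S -> (dX \x dY)%E S = dZ S.
  apply: product_measure_unique => A B mA mB.
  rewrite /dZ /distribution /pushforward/= -XY//; congr (P _).
have mf : measurable_fun setT (fun z : R * R => (z.1 * z.2)%:E).
  apply/measurable_EFinP; apply: measurable_funM; exact: measurable_fst || exact: measurable_snd.
have mE : measurable_fun [set: R] (@EFin R) by exact/measurable_EFinP.
have mA (f : R * R -> \bar R) : measurable_fun setT f -> (forall z, 0 <= f z)%E ->
    (\int[P]_w f (X w, Y w) = \int[dX \x dY]_z f z)%E.
  move=> mf' f0; transitivity (\int[dZ]_z f z)%E.
    by rewrite ge0_integral_distribution.
  by apply: eq_measure_integral => A mS _; exact/esym/dE.
have absE (W : {mfun Omega >-> R}) : P.-integrable setT (EFin \o W) ->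
    (distribution P W).-integrable setT (@EFin R).
  move=> /integrableP[_ iW]; apply/integrableP; split => //.
  by rewrite ge0_integral_distribution//; exact: measurableT_comp.
have idX : dX.-integrable setT (@EFin R) by exact: absE.
have idY : dY.-integrable setT (@EFin R) by exact: absE.
have EX : (\int[dX]_x x%:E = \int[P]_w (X w)%:E)%E.
  by rewrite integral_distribution.
have EY : (\int[dY]_x x%:E = \int[P]_w (Y w)%:E)%E.
  by rewrite integral_distribution.
have fX : (\int[P]_w (X w)%:E)%E \is a fin_num by exact: integrable_fin_num.
have fY : (\int[P]_w (Y w)%:E)%E \is a fin_num by exact: integrable_fin_num.
have imf : (dX \x dY)%E.-integrable setT (fun z : R * R => (z.1 * z.2)%:E).
  apply/integrable12ltyP => //=.
  have /integrableP[_ ix] := idX; have /integrableP[_ iy] := idY.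
  under eq_integral => x _.
    under eq_integral do rewrite normrM EFinM.
    rewrite ge0_integralZl//=; last exact: measurableT_comp.
    over.
  rewrite ge0_integralZr//=; [|exact: measurableT_comp|exact: integral_ge0].
  by rewrite lte_mul_pinfty//; [exact: integral_ge0|
    rewrite ge0_fin_numE//; exact: integral_ge0].
have iZ : P.-integrable setT (EFin \o (fun w => X w * Y w)).
  apply/integrableP; split.
    by apply/measurable_EFinP; exact: measurable_funM.
  rewrite (mA (fun z => `|(z.1 * z.2)%:E|%E))//; last exact: measurableT_comp.
  by have /integrableP[] := imf.
split => //.
rewrite {1}/Rintegral.
have -> : (\int[P]_w (X w * Y w)%:E = \int[dZ]_z (z.1 * z.2)%:E)%E.
  by rewrite integral_distribution.
have -> : (\int[dZ]_z (z.1 * z.2)%:E = \int[dX \x dY]_z (z.1 * z.2)%:E)%E.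
  by apply: eq_measure_integral => A mS _; exact/esym/dE.
rewrite -integral12_prod_meas1//= /fubini_F /=.
under eq_integral => x _.
  under eq_integral do rewrite EFinM.
  rewrite integralZl//= EY -(fineK fY).
  over.
by rewrite integralZr//= EX fineM.
Qed.

End independence.

(** * Moments of the centred normal law *)

Section normal_moments.
Local Open Scope classical_set_scope.
Local Open Scope ring_scope.
Variables (R : realType) (s : R).
Hypothesis s0 : s != 0.
Notation mu := (@lebesgue_measure R).
Notation p := (normal_pdf 0 s).
Notation N := (normal_prob 0 s).

Lemma is_derive_normal_pdf (x : R) :
  is_derive x 1 p (- (s ^+ 2)^-1 * (x * p x)).
Proof.
have E : p = fun x : R => normal_peak s * expR (- (s ^+ 2 *+ 2)^-1 * x ^+ 2).
  apply/funext => t; rewrite normal_pdfE// /normal_fun subr0.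
  by congr (_ * expR _); rewrite mulNr mulrC mulNr.
rewrite E.
apply: is_derive_eq.
rewrite /GRing.scale/= -[s ^+ 2 *+ 2]mulr_natl.
by field; rewrite s0.
Qed.

Lemma is_derive_continuous (f : R -> R) (g : R -> R) :
  (forall x : R, is_derive x 1 f (g x)) -> continuous f.
Proof.
by move=> h x; apply/differentiable_continuous/derivable1_diffP; case: (h x).
Qed.

Lemma is_derive_LRcontinuous (f g : R -> R) (a b : R) :
  (forall x : R, is_derive x 1 f (g x)) -> derivable_oo_LRcontinuous f a b.
Proof.
move=> h; have c := is_derive_continuous h; split.
- by move=> x _; case: (h x).
- exact/cvg_at_right_filter/c.
- exact/cvg_at_left_filter/c.
Qed.

Lemma is_derive_derive1 (f g : R -> R) (x : R) :
  is_derive x 1 f (g x) -> f^`()%classic x = g x.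
Proof. by move=> h; rewrite derive1E; case: h. Qed.

(** The normal density is a Radon-Nikodym derivative of the law with respect to
    Lebesgue measure, and such derivatives are unique almost everywhere. *)
Lemma integral_normal_prob (f : R -> R) (U : set R) : measurable U ->
  measurable_fun U f -> (\int[N]_(x in U) `|(f x)%:E| < +oo)%E ->
  (\int[N]_(x in U) (f x)%:E = \int[mu]_(x in U) (f x * p x)%:E)%E.
Proof.
move=> mU mf finf.
have mp : measurable_fun U (p : R -> R) by apply: measurable_funTS; exact: measurable_normal_pdf.
have mEf : measurable_fun U (EFin \o f) by exact/measurable_EFinP.
have dom := normal_prob_dominates 0 s.
rewrite -(Radon_Nikodym_change_of_variables dom)//=; last first.
  by apply/integrableP; split.
apply: ae_eq_integral => //.
- apply: emeasurable_funM => //; apply: (measurable_int mu).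
  apply: (integrableS _ _ (@subsetT _ _)) => //=.
  exact: Radon_Nikodym_integrable.
- by apply/measurable_EFinP; exact: measurable_funM.
- under [X in ae_eq _ _ _ X]eq_fun do rewrite EFinM.
  apply: ae_eqe_mul2l => /=.
  rewrite Radon_NikodymE//=.
  case: cid => /= h [h1 h2 h3].
  apply: integral_ae_eq => //=.
  + exact: integrableS h2.
  + exact/measurable_EFinP.
  + by move=> E E01 mE; rewrite -h3.
Qed.

Let cp : continuous (p : R -> R).
Proof. exact: continuous_normal_pdf. Qed.

Let I (M : R) : set R := `[(- M), M]%classic.

Let bounded_lty (f : R -> R) (C M : R) : measurable_fun [set: R] f ->
  (forall x, I M x -> `|f x| <= C) -> (\int[N]_(x in I M) `|(f x)%:E| < +oo)%E.
Proof.
move=> mf fC; have mI : measurable (I M) by exact: measurable_itv.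
apply: (@le_lt_trans _ _ (\int[N]_(x in I M) C%:E)%E).
  apply: ge0_le_integral => //.
  by apply: measurableT_comp => //; apply/measurable_EFinP; exact: measurable_funTS.
rewrite integral_cst//; apply: le_lt_trans (ltry `|C|).
rewrite -[X in (_ <= X)%E]mule1; apply: (@le_trans _ _ (`|C|%:E * N (I M))%E).
  by apply: lee_wpmul2r => //; rewrite lee_fin ler_norm.
by apply: lee_wpmul2l => //; exact: probability_le1.
Qed.

(** x p(x) is the derivative of - s^2 p(x), and p is even. *)
Lemma normal_truncated_mean (M : R) : 0 < M ->
  (\int[N]_(x in `[(- M)%R, M]) x%:E = 0)%E.
Proof.
move=> M0; rewrite (@integral_normal_prob id)//; last first.
  apply: (@bounded_lty id M) => // x; rewrite /I/= in_itv/= => /andP[? ?].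
  by rewrite ler_norml; apply/andP.
rewrite (@continuous_FTC2 _ _ (fun x => - s ^+ 2 * p x))//=.
- rewrite -EFinB normal_pdfE// /normal_fun !subr0 sqrrN; congr EFin; ring.
- lra.
- by apply: continuous_subspaceT => x; apply: cvgM => //; exact: cp.
- apply: (@is_derive_LRcontinuous _ (fun x => x * p x)) => x.
  have := is_derive_normal_pdf x => ?.
  apply: is_derive_eq; rewrite /GRing.scale/=.
  by field; rewrite s0.
- move=> x _; apply: (@is_derive_derive1 _ (fun x => x * p x)).
  have := is_derive_normal_pdf x => ?.
  apply: is_derive_eq; rewrite /GRing.scale/=.
  by field; rewrite s0.
Qed.

(** Integration by parts of x against x p(x) = (- s^2 p(x))' leaves s^2 times the
    mass of the interval plus a boundary term - 2 M s^2 p(M), whose sign is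
    favourable. *)
Lemma normal_truncated_var (M : R) : 0 < M ->
  (\int[N]_(x in `[(- M)%R, M]) (x ^+ 2)%:E <= (s ^+ 2)%:E)%E.
Proof.
move=> M0; rewrite (@integral_normal_prob (fun x => x ^+ 2))//; last first.
  apply: (@bounded_lty (fun x => x ^+ 2) (M ^+ 2)) => //.
  move=> x; rewrite /I/= in_itv/= => /andP[? ?].
  by rewrite ger0_norm ?sqr_ge0//; nra.
have dG (x : R) : is_derive x 1 (fun x : R => - s ^+ 2 * p x) (x * p x).
  have := is_derive_normal_pdf x => ?.
  apply: is_derive_eq; rewrite /GRing.scale/=.
  by field; rewrite s0.
have dF (x : R) : is_derive x 1 (@id R) 1 by exact: is_derive_id.
under eq_integral => x _ do rewrite expr2 -mulrA.
rewrite (@integration_by_parts _ id (fun x => - s ^+ 2 * p x) (fun=> 1)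
  (fun x => x * p x))//=; first last.
- by move=> x _; exact: (@is_derive_derive1 _ (fun x => x * p x)).
- exact: is_derive_LRcontinuous dG.
- by apply: continuous_subspaceT => x; apply: cvgM => //; exact: cp.
- by move=> x _; exact: (@is_derive_derive1 _ (fun=> 1)).
- exact: (@is_derive_LRcontinuous _ (fun=> 1)).
- by apply: continuous_subspaceT => x; exact: cvg_cst.
- lra.
under eq_integral do rewrite mul1r EFinM.
rewrite integralZl//=; last first.
  by apply: integrableS (integrable_normal_pdf 0 s).
have pM (x : R) : 0 <= p x by exact: normal_pdf_ge0.
have N1 : (\int[mu]_(x in `[(- M)%R, M]) (p x)%:E <= 1)%E.
  by apply: (@probability_le1 _ _ _ N); exact: measurable_itv.
have N0 : (0 <= \int[mu]_(x in `[(- M)%R, M]) (p x)%:E)%E.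
  by apply: integral_ge0 => x _; rewrite lee_fin.
rewrite EFinN mulNe oppeK -[leRHS]add0e; apply: leeD.
  rewrite lee_fin; have := pM M; have := pM (- M).
  have := sqr_ge0 s; move: (s ^+ 2) => c c0 a b.
  have : 0 <= M * (c * p M) by rewrite !mulr_ge0// ltW.
  have : 0 <= M * (c * p (- M)) by rewrite !mulr_ge0// ltW.
  nra.
rewrite -[leRHS]mule1; apply: lee_wpmul2l => //.
by rewrite lee_fin sqr_ge0.
Qed.

Let bigcupI : \bigcup_k I k.+1%:R = [set: R].
Proof.
apply/seteqP; split => // x _; exists (Num.truncn `|x|) => //.
by rewrite /I/= in_itv/= -ler_norml ltW// truncnS_gt.
Qed.

Let ndI : nondecreasing_seq (fun k : nat => I k.+1%:R).
Proof.
move=> m k mk; apply/subsetPset => x; rewrite /I/= !in_itv/= => /andP[a b].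
have : (m.+1%:R : R) <= k.+1%:R by rewrite ler_nat.
by move=> h; apply/andP; split; lra.
Qed.

(** Monotone limit of the truncated moments. *)
Lemma normal_second_moment : (\int[N]_x (x ^+ 2)%:E <= (s ^+ 2)%:E)%E.
Proof.
rewrite -bigcupI.
have mX2 : measurable_fun [set: R] (fun x : R => (x ^+ 2)%:E).
  by apply/measurable_EFinP.
have c := @ge0_nondecreasing_set_cvg_integral _ (measurableTypeR R) R _
  (fun x : R => (x ^+ 2)%:E)
  (normal_prob 0 s) ndI (fun k => measurable_itv _) (fun k => measurable_funTS mX2)
  (fun k x _ => (sqr_ge0 x : (0 <= (x ^+ 2)%:E)%E)).
have /cvg_lim <- // := c.
apply: lime_le; first exact: cvgP c.
by near=> k; exact: normal_truncated_var.
Unshelve. all: by end_near.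
Qed.

Let PN : probability (measurableTypeR R) R := normal_prob 0 s.

Lemma integrable_normal_sqr :
  PN.-integrable setT (EFin \o (fun x : R => x ^+ 2)).
Proof.
apply/integrableP; split; first exact/measurable_EFinP.
under eq_integral => x _ do rewrite /= ger0_norm ?sqr_ge0//.
by apply: le_lt_trans normal_second_moment _; rewrite ltry.
Qed.

Lemma integrable_normal_id : PN.-integrable setT (EFin \o (@id R)).
Proof. by apply: integrable_sqr integrable_normal_sqr. Qed.

(** Dominated limit of the truncated means; |x| is integrable because x^2 is. *)
Lemma normal_mean : (\int[normal_prob 0 s]_x x%:E = 0)%E.
Proof.
have iX := integrable_normal_id.
have mI (k : nat) : measurable (I k.+1%:R : set (measurableTypeR R)).
  exact: measurable_itv.
have mid : measurable_fun [set: measurableTypeR R] (@EFin R).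
  exact/measurable_EFinP.
have [|||||_ _] := @dominated_convergence _ (measurableTypeR R) R PN setT measurableT
  (fun k => (@EFin R) \_ (I k.+1%:R)) (@EFin R) (fun x => `|x|%:E).
- by move=> k; apply/(measurable_restrictT _ (mI k)); exact: measurable_funTS.
- by [].
- apply: aeW => x _; apply: (@cvg_near_cst _ _ _ _ _ _).
  near=> k; rewrite patchE mem_set// /I/= in_itv/= -ler_norml.
  near: k; apply: filterS (nbhs_infty_ger (Num.norm x)) => k /= h.
  by rewrite (le_trans h)// ler_nat.
- exact: integrable_norm.
- apply: aeW => x k _; rewrite patchE; case: ifPn => _//=.
  by rewrite normr0 lee_fin.
move=> h; have : (fun k => \int[PN]_x ((@EFin R) \_ (I k.+1%:R)) x)%E @ \oo --> 0%E.
  apply: cvg_near_cst; apply: nearW => k.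
  by rewrite -integral_mkcond; exact: normal_truncated_mean.
by move=> h0; apply/esym; apply: (cvg_unique _ h0 h).
Unshelve. all: by end_near.
Qed.

End normal_moments.

(** * Brownian increments are independent of the past *)

Section measurable_wrt.
Local Open Scope classical_set_scope.
Local Open Scope ring_scope.
Context (R : realType) (disp : measure_display) (Omega : measurableType disp).
Implicit Types (G : set (set Omega)) (X : Omega -> R).

(** Stated on the measurable type generated by G so that the closure properties of
    measurable functions apply to a fixed stage of a filtration. *)
Definition measurable_wrt G X : Prop :=
  measurable_fun setT (X : g_sigma_algebraType G -> R).

Lemma measurable_wrt_preimage G X (A : set R) : sigma_algebra setT G ->
  measurable_wrt G X -> measurable A -> G (X @^-1` A).
Proof.
move=> sG mX mA; have := mX measurableT A mA.
by rewrite setTI /measurable/= sigma_algebra_id.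
Qed.

Lemma measurable_wrt_intro G X :
  (forall A : set R, measurable A -> G (X @^-1` A)) -> measurable_wrt G X.
Proof. by move=> h _ A mA; rewrite setTI; apply: sub_sigma_algebra; exact: h. Qed.

Lemma measurable_wrt_sub G G' X : sigma_algebra setT G -> G `<=` G' ->
  measurable_wrt G X -> measurable_wrt G' X.
Proof.
move=> sG GG' mX; apply: measurable_wrt_intro => A mA; apply: GG'.
exact: measurable_wrt_preimage.
Qed.

Lemma measurable_wrt_measurable G X : sigma_algebra setT G ->
  G `<=` measurable -> measurable_wrt G X -> measurable_fun setT X.
Proof.
move=> sG GG' mX _ A mA; rewrite setTI; apply: GG'.
exact: measurable_wrt_preimage.
Qed.

Lemma measurable_wrt_indic G (A : set Omega) : G A ->
  measurable_wrt G (\1_A : Omega -> R).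
Proof.
move=> GA; apply: (@measurable_indic _ (g_sigma_algebraType G)).
exact: sub_sigma_algebra.
Qed.

End measurable_wrt.

Section increments.
Local Open Scope classical_set_scope.
Local Open Scope ring_scope.
Context (R : realType) (disp : measure_display) (Omega : measurableType disp).
Variables (P : probability Omega R) (Fil : R -> set (set Omega)).
Variables (d : nat) (B : R -> Omega -> 'cV[R]_d).
Hypothesis usual : usual_filtration P Fil.
Hypothesis brownian : brownian_motion P Fil B.
Implicit Types X : Omega -> R.

Lemma brownian_adapted (t : R) (i : 'I_d) : 0 <= t ->
  measurable_wrt (Fil t) (fun w => B t w i ord0).
Proof.
move=> t0; apply: measurable_wrt_intro => A mA; apply: (bm_adapted brownian) => //.
by apply: sub_sigma_algebra; exists i, A.
Qed.

Variables (s t : R).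
Hypotheses (s_ge0 : 0 <= s) (st : s < t).

Let v (i : 'I_d) (w : Omega) : R := (B t w - B s w) i ord0.
Let t_ge0 : 0 <= t. Proof. by rewrite (le_trans s_ge0)// ltW. Qed.

Lemma increment_adapted (i : 'I_d) : measurable_wrt (Fil t) (v i).
Proof.
have -> : v i = fun w => B t w i ord0 - B s w i ord0.
  by apply/funext => w; rewrite /v !mxE.
apply: measurable_funB; first exact: brownian_adapted.
apply: measurable_wrt_sub (filt_sigma usual s_ge0) _ (brownian_adapted i s_ge0).
by apply: filt_mono usual _ _ _ _; rewrite // ltW.
Qed.

Lemma increment_measurable (i : 'I_d) : measurable_fun setT (v i).
Proof.
apply: measurable_wrt_measurable (filt_sigma usual t_ge0) _ (increment_adapted i).
exact: (filt_meas usual).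
Qed.

Let sd : R := Num.sqrt (t - s).

Let sd0 : sd != 0.
Proof. by rewrite gt_eqF// sqrtr_gt0 subr_gt0. Qed.

Let sd2 : sd ^+ 2 = t - s.
Proof. by rewrite sqr_sqrtr// subr_ge0 ltW. Qed.

Lemma increment_law (i : 'I_d) (A : set R) : measurable A ->
  P (v i @^-1` A) = normal_prob 0 sd A.
Proof.
move=> mA; pose A' (k : 'I_d) : set (measurableTypeR R) := if k == i then A else setT.
have mA' k : measurable (A' k) by rewrite /A'; case: ifP.
have <- : [set w | forall k, A' k (v k w)] = v i @^-1` A.
  apply/seteqP; split => w /=; first by move=> /(_ i); rewrite /A' eqxx.
  by move=> Aw k; rewrite /A'; case: eqP => [->|].
rewrite (bm_gaussian brownian) // (bigD1 i)//= {1}/A' eqxx big1 ?mule1// => k ki.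
by rewrite /A' (negbTE ki) probability_setT.
Qed.

(** The Gaussian law of the increment is a product over the coordinates; the
    coordinates other than i and j are left unconstrained. *)
Lemma increment_law2 (i j : 'I_d) (A A2 : set R) : i != j ->
  measurable A -> measurable A2 ->
  P (v i @^-1` A `&` v j @^-1` A2) = (P (v i @^-1` A) * P (v j @^-1` A2))%E.
Proof.
move=> ij mA mA2; rewrite !increment_law//.
pose A' (k : 'I_d) : set (measurableTypeR R) :=
  if k == i then A else if k == j then A2 else setT.
have mA' k : measurable (A' k) by rewrite /A'; case: ifP => // _; case: ifP.
have <- : [set w | forall k, A' k (v k w)] = v i @^-1` A `&` v j @^-1` A2.
  apply/seteqP; split => w /=.
    by move=> h; split; [have := h i|have := h j]; rewrite /A' eqxx// eq_sym (negbTE ij).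
  by move=> [Aw A2w] k; rewrite /A'; case: eqP => [->//|_]; case: eqP => [->|].
rewrite (bm_gaussian brownian) // (bigD1 i)//= (bigD1 j)/=; last by rewrite eq_sym.
rewrite {1 2}/A' eqxx eq_sym (negbTE ij) eqxx big1 ?mule1// => k /andP[ki kj].
by rewrite /A' (negbTE ki) (negbTE kj) probability_setT.
Qed.

Let measurable_v (i : 'I_d) :
  @measurable_fun _ _ Omega (measurableTypeR R) setT (v i).
Proof. exact: increment_measurable. Qed.

Let vm (i : 'I_d) : {mfun Omega >-> measurableTypeR R} :=
  @mfun_Sub _ _ Omega (measurableTypeR R) (v i) (mem_set (measurable_v i)).

Let integral_increment (i : 'I_d) (f : R -> \bar R) :
  measurable_fun setT f -> (forall x, 0 <= f x)%E ->
  (\int[P]_w f (v i w) = \int[normal_prob 0 sd]_x f x)%E.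
Proof.
move=> mf f0; transitivity (\int[distribution P (vm i)]_x f x)%E.
  by rewrite ge0_integral_distribution.
by apply: eq_measure_integral => A mA _; exact: increment_law.
Qed.

Lemma integrable_increment_sqr (i : 'I_d) :
  P.-integrable setT (EFin \o (fun w => v i w ^+ 2)).
Proof.
apply/integrableP; split.
  by apply/measurable_EFinP; apply: measurable_funX; exact: increment_measurable.
rewrite (integral_increment i (f := fun x => `|(x ^+ 2)%:E|%E))//; last first.
  by apply: measurableT_comp => //; apply/measurable_EFinP.
by have /integrableP[] := integrable_normal_sqr sd0.
Qed.

Lemma increment_variance_le (i : 'I_d) : \int[P]_w (v i w ^+ 2) <= t - s.
Proof.
rewrite -lee_fin /Rintegral fineK; last first.
  by apply: integrable_fin_num => //; exact: integrable_increment_sqr.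
rewrite (integral_increment i (f := fun x => (x ^+ 2)%:E))//.
- by rewrite -sd2; exact: normal_second_moment.
- exact/measurable_EFinP.
- by move=> x; rewrite lee_fin sqr_ge0.
Qed.

Lemma increment_mean (i : 'I_d) : has_mean P (v i) 0.
Proof.
have iv : P.-integrable setT (EFin \o v i).
  by apply: integrable_sqr (integrable_increment_sqr i); exact: increment_measurable.
split => //; rewrite /Rintegral.
transitivity (fine (\int[distribution P (vm i)]_x x%:E)%E).
  by rewrite integral_distribution//; exact/measurable_EFinP.
rewrite (eq_measure_integral (normal_prob 0 sd)); last first.
  by move=> A mA _; exact: increment_law.
by rewrite normal_mean.
Qed.

(** Distinct coordinates of the increment are independent and centred. *)
Lemma increment_covariance (i j : 'I_d) : i != j ->
  has_mean P (fun w => v i w * v j w) 0.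
Proof.
move=> ij; apply: has_mean_eq (mul0r 0) _; apply: independent_mean.
- exact: increment_measurable.
- exact: increment_measurable.
- by move=> A A2 mA mA2; exact: increment_law2.
- exact: increment_mean.
- exact: increment_mean.
Qed.

Let sv : set (set Omega) := [set E | exists (i : 'I_d) (A : set (measurableTypeR R)),
         measurable A /\ E = v i @^-1` A].

Lemma increment_independent X (Y : Omega -> R) (a b : R) :
  measurable_wrt (Fil s) X -> measurable_wrt sv Y ->
  has_mean P X a -> has_mean P Y b ->
  measurable_fun setT Y ->
  has_mean P (fun w => X w * Y w) (a * b).
Proof.
move=> mX mY hX hY mY'; apply: independent_mean => //.
  apply: measurable_wrt_measurable (filt_sigma usual s_ge0) _ mX.
  exact: (filt_meas usual).
move=> A A2 mA mA2; apply: (bm_indep brownian s_ge0 st).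
  exact: measurable_wrt_preimage (filt_sigma usual s_ge0) mX mA.
by have := mY measurableT A2 mA2; rewrite setTI.
Qed.

Let mv i : measurable_wrt sv (v i).
Proof.
by apply: measurable_wrt_intro => A mA; exists i, A.
Qed.

Lemma mean_mul_increment X (a : R) (i : 'I_d) :
  measurable_wrt (Fil s) X -> has_mean P X a ->
  has_mean P (fun w => X w * v i w) 0.
Proof.
move=> mX hX; apply: has_mean_eq (mulr0 a) _.
apply: increment_independent => //; first exact: increment_mean.
exact: increment_measurable.
Qed.

Lemma mean_mul_increment2 X (a : R) (i j : 'I_d) :
  measurable_wrt (Fil s) X -> has_mean P X a ->
  has_mean P (fun w => X w * (v i w * v j w))
   (a * (if i == j then \int[P]_w (v i w ^+ 2) else 0)).
Proof.
move=> mX hX; apply: increment_independent => //.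
- by apply: measurable_funM; exact: mv.
- case: eqP => [<-|/eqP ij]; last exact: increment_covariance.
  apply: has_mean_ext (has_mean_intro (integrable_increment_sqr i)) => w.
  by rewrite expr2.
- by apply: measurable_funM; exact: increment_measurable.
Qed.

Let measurable_of X : measurable_wrt (Fil s) X -> measurable_fun setT X.
Proof.
apply: measurable_wrt_measurable (filt_sigma usual s_ge0) _.
exact: (filt_meas usual).
Qed.

Lemma integrable_entry_sqr m n (M : Omega -> 'M[R]_(m, n)) i j :
  measurable_fun setT (fun w => M w i j) ->
  P.-integrable setT (EFin \o (fun w => enorm (M w) ^+ 2)) ->
  P.-integrable setT (EFin \o (fun w => M w i j ^+ 2)).
Proof.
move=> mM iM; apply: integrable_dom iM _; first exact: measurable_funX.
by move=> w; rewrite ger0_norm ?sqr_ge0//; exact: entry_le_enorm2.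
Qed.

(** In |X + G v|^2 the terms X_a G_ai v_i have mean zero, and so have the terms
    G_ai G_aj v_i v_j with i <> j, because the increment v is independent of X
    and G. What remains is |X|^2 and the sum of G_ai^2 v_i^2, and E v_i^2 is at
    most t - s. *)
Lemma noise_step n (X : Omega -> 'cV[R]_n) (G : Omega -> 'M[R]_(n, d)) :
  (forall a, measurable_wrt (Fil s) (fun w => X w a ord0)) ->
  (forall a i, measurable_wrt (Fil s) (fun w => G w a i)) ->
  P.-integrable setT (EFin \o (fun w => enorm (X w) ^+ 2)) ->
  P.-integrable setT (EFin \o (fun w => enorm (G w) ^+ 2)) ->
  exists2 m, has_mean P (fun w => enorm (X w + G w *m (B t w - B s w)) ^+ 2) m &
    m <= \int[P]_w (enorm (X w) ^+ 2) + (t - s) * \int[P]_w (enorm (G w) ^+ 2).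
Proof.
move=> mX mG iX iG.
have iX2 a : P.-integrable setT (EFin \o (fun w => X w a ord0 ^+ 2)).
  by apply: integrable_entry_sqr => //; exact/measurable_of.
have iG2 a i : P.-integrable setT (EFin \o (fun w => G w a i ^+ 2)).
  by apply: integrable_entry_sqr => //; exact/measurable_of.
have iXG a i : P.-integrable setT (EFin \o (fun w => X w a ord0 * G w a i)).
  by apply: integrable_mul => //; exact/measurable_of.
have iGG a i j : P.-integrable setT (EFin \o (fun w => G w a i * G w a j)).
  by apply: integrable_mul => //; exact/measurable_of.
have hm a : has_mean P (fun w =>
    X w a ord0 ^+ 2 + (2 * \sum_i (X w a ord0 * G w a i) * v i w
     + \sum_i \sum_j (G w a i * G w a j) * (v i w * v j w)))
   (\int[P]_w (X w a ord0 ^+ 2) + (2 * \sum_(i < d) 0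
     + \sum_i \sum_j (\int[P]_w (G w a i * G w a j)) *
         (if i == j then \int[P]_w (v i w ^+ 2) else 0))).
  apply: has_meanD; first exact: has_mean_intro.
  apply: has_meanD.
    apply: has_meanZ; apply: has_mean_sum => i.
    apply: mean_mul_increment (has_mean_intro (iXG a i)).
    by apply: measurable_funM; [exact: mX|exact: mG].
  apply: has_mean_sum => i; apply: has_mean_sum => j.
  apply: mean_mul_increment2 (has_mean_intro (iGG a i j)).
  by apply: measurable_funM; exact: mG.
eexists.
  apply: has_mean_ext (has_mean_sum (index_enum 'I_n) xpredT hm) => w.
  rewrite enorm2E; apply: eq_bigr => a _; rewrite big_ord1 !mxE.
  (* z is the a-th coordinate of the noise G v *)
  set x := X w a ord0; set z := (Y in _ = (_ + Y) ^+ 2).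
  have -> : \sum_i x * G w a i * v i w = x * z.
    by rewrite /z mulr_sumr; apply: eq_bigr => i _; rewrite -mulrA.
  have -> : \sum_i \sum_j G w a i * G w a j * (v i w * v j w) = z * z.
    rewrite /z mulr_suml; apply: eq_bigr => i _; rewrite mulr_sumr.
    by apply: eq_bigr => j _; rewrite mulrACA.
  by ring.
have EX : \int[P]_w (enorm (X w) ^+ 2) = \sum_a \int[P]_w (X w a ord0 ^+ 2).
  apply: has_mean_uniq (has_mean_intro iX) _.
  apply: has_mean_ext (has_mean_sum _ _ (fun a => has_mean_intro (iX2 a))) => w.
  by rewrite enorm2E; apply: eq_bigr => a _; rewrite big_ord1.
have EG : \int[P]_w (enorm (G w) ^+ 2) = \sum_a \sum_i \int[P]_w (G w a i ^+ 2).
  apply: has_mean_uniq (has_mean_intro iG) _.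
  apply: has_mean_ext (has_mean_sum _ _ (fun a => has_mean_sum _ _
    (fun i => has_mean_intro (iG2 a i)))) => w.
  by rewrite enorm2E.
rewrite EX EG [X in _ <= _ + X]mulr_sumr -big_split/=; apply: ler_sum => a _.
rewrite lerD2l big1// mulr0 add0r mulr_sumr; apply: ler_sum => i _.
rewrite (bigD1 i)//= eqxx big1 ?addr0; last first.
  by move=> j ji; rewrite eq_sym (negbTE ji) mulr0.
have -> : \int[P]_w (G w a i * G w a i) = \int[P]_w (G w a i ^+ 2).
  by apply: eq_Rintegral => w _; rewrite expr2.
rewrite [leRHS]mulrC; apply: ler_wpM2l; last exact: increment_variance_le.
by apply: Rintegral_ge0 => w _; exact: sqr_ge0.
Qed.

End increments.

(** * Nonnegative supermartingales are almost surely bounded *)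

Section supermartingale.
Local Open Scope classical_set_scope.
Local Open Scope ring_scope.
Context (R : realType) (disp : measure_display) (Omega : measurableType disp).
Variables (P : probability Omega R) (F : nat -> set (set Omega)).
Hypothesis F_sigma : forall k, sigma_algebra setT (F k).
Hypothesis F_meas : forall k, F k `<=` measurable.
Hypothesis F_mono : forall k, F k `<=` F k.+1.

Let F_measurable k : F k = @measurable _ (g_sigma_algebraType (F k)).
Proof. by rewrite /measurable/= sigma_algebra_id. Qed.

Let F_T k : F k setT.
Proof. by rewrite F_measurable; exact: measurableT. Qed.

Let F_I k A A' : F k A -> F k A' -> F k (A `&` A').
Proof. by rewrite F_measurable; exact: measurableI. Qed.

Section maximal.
Variable V : nat -> Omega -> R.
Hypothesis V_ge0 : forall k w, 0 <= V k w.
Hypothesis V_adapted : forall k, measurable_wrt (F k) (V k).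
Hypothesis V_int : forall k, P.-integrable setT (EFin \o V k).
Hypothesis V_super : forall k (A : set Omega), F k A ->
  \int[P]_w (\1_A w * V k.+1 w) <= \int[P]_w (\1_A w * V k w).

Lemma supermartingale_mean_le k : \int[P]_w V k w <= \int[P]_w V 0%N w.
Proof.
elim: k => // k IH; apply: le_trans IH.
have E j : \int[P]_w V j w = \int[P]_w (\1_[set: Omega] w * V j w).
  by apply: eq_Rintegral => w _; rewrite indicT mul1r.
by rewrite !E; apply: V_super.
Qed.

(** The event that V stays under level l before time m. It is decided by the
    values strictly before m. *)
Fixpoint below (l : R) (m : nat) : set Omega :=
  if m is m'.+1 then below l m' `&` (V m' @^-1` [set x | x < l]) else setT.

Let F_lt l k : F k (V k @^-1` [set x | x < l]).
Proof.
apply: measurable_wrt_preimage => //; rewrite -set_itvNyo; exact: measurable_itv.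
Qed.

Let below_F l k : F k (below l k.+1).
Proof.
elim: k => [|k IH]; first exact: F_I.
by apply: F_I => //; apply: F_mono; exact: IH.
Qed.

Let below_measurable l m : measurable (below l m).
Proof. by case: m => [|m]; [exact: measurableT|apply: F_meas; exact: below_F]. Qed.

Let stopped_mean l m k :
  has_mean P (fun w => \1_(below l k) w * V m w + l * (1 - \1_(below l k) w))
    (\int[P]_w (\1_(below l k) w * V m w) + l * (1 - fine (P (below l k)))).
Proof.
apply: has_meanD.
  by apply: has_mean_intro; exact: integrable_indicM.
apply: has_meanZ; apply: has_meanB; first exact: has_mean_cst.
split; first exact: integrable_indic.
by rewrite /Rintegral integral_indic// setIT.
Qed.

(** Stopping V at the first passage above l and replacing it from then on by the
    constant l only decreases its mean: the stopped mean u is non-increasing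
    in m, starts at E V_0, and is at least l times the probability of having
    passed. *)
Lemma maximal_inequality l m :
  l * (1 - fine (P (below l m))) <= \int[P]_w V 0%N w.
Proof.
pose u k := \int[P]_w (\1_(below l k) w * V k w) + l * (1 - fine (P (below l k))).
have u0 : u 0%N = \int[P]_w V 0%N w.
  rewrite /u/= probability_setT subrr mulr0 addr0.
  by apply: eq_Rintegral => w _; rewrite indicT mul1r.
have uS k : u k.+1 <= u k.
  apply: (@le_trans _ _ (\int[P]_w (\1_(below l k.+1) w * V k w)
     + l * (1 - fine (P (below l k.+1))))).
    by rewrite lerD2r; apply: V_super; exact: below_F.
  (* pathwise: on the paths that pass l exactly at time k, l replaces the larger
     value V k *)
  apply: has_mean_le (stopped_mean l k k.+1) (stopped_mean l k k) _ => w.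
  rewrite !indicE; have [|] := boolP (w \in below l k.+1).
    by rewrite inE/= => -[wk _]; rewrite mem_set.
  rewrite notin_setE/= => h; have [|] := boolP (w \in below l k); last first.
    by rewrite mul0r.
  rewrite inE => wk; have /negP : ~ (V k w < l) by move=> lt; apply: h.
  by rewrite -leNgt => lV; rewrite subrr mulr0 addr0 mul0r add0r subr0 mulr1 mul1r.
rewrite -u0; apply: (@le_trans _ _ (u m)); last first.
  by elim: m => // m IH; apply: le_trans IH.
by rewrite /u lerDr; apply: Rintegral_ge0 => w _; rewrite mulr_ge0// indicE.
Qed.

(** A path is unbounded only if it passes every level l + 1, which by the maximal
    inequality has probability at most E V_0 / (l + 1). *)
Lemma supermartingale_bounded_ae :
  {ae P, forall w, exists C, forall k, V k w <= C}.
Proof.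
pose C0 := \int[P]_w V 0%N w.
pose U (l : nat) := \bigcup_m (~` below l.+1%:R m).
have mU l : measurable (U l).
  by apply: bigcupT_measurable => m; apply: measurableC.
have PU l : (P (U l) <= (C0 / l.+1%:R)%:E)%E.
  have c : P (~` below l.+1%:R m) @[m --> \oo] --> P (U l).
    apply: nondecreasing_cvg_mu => //.
      by move=> m; apply: measurableC.
    exact: mU.
    by apply/nondecreasing_seqP => m; apply/subsetPset/subsetC => w [].
  rewrite -(cvg_lim _ c)//; apply: lime_le; first exact: cvgP c.
  apply: nearW => m; rewrite probability_setC//.
  rewrite -[P _]fineK ?fin_num_measure// -EFinB lee_fin.
  rewrite ler_pdivlMr// mulrC; exact: maximal_inequality.
exists (\bigcap_l U l); split.
- exact: bigcapT_measurable.
- apply/eqP; rewrite eq_le measure_ge0 andbT.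
  have mb : measurable (\bigcap_l U l) by exact: bigcapT_measurable.
  have h l : fine (P (\bigcap_l U l)) <= C0 / l.+1%:R.
    rewrite -lee_fin fineK ?fin_num_measure//; apply: le_trans (PU l).
    by apply: le_measure; rewrite ?inE//; exact: bigcap_inf.
  rewrite -[P _]fineK ?fin_num_measure// lee_fin leNgt; apply/negP.
  set p := fine _ => p0.
  have := h (Num.truncn (C0 / p)); rewrite -/p ler_pdivlMr//.
  have := truncnS_gt (C0 / p); rewrite ltr_pdivrMr// mulrC => a b.
  by have := lt_le_trans a b; rewrite ltxx.
- move=> w /= nb l _; apply: contrapT => nU; apply: nb; exists l.+1%:R => k.
  have : below l.+1%:R k.+1 w.
    by apply: contrapT => nk; apply: nU; exists k.+1.
  by move=> [_ /=]; exact: ltW.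
Qed.

End maximal.
End supermartingale.

(** * A Lyapunov functional for recursions with delay *)

Section lyapunov.
Local Open Scope classical_set_scope.
Local Open Scope ring_scope.
Variable R : realType.
Variables (K : nat) (q : R) (w gamma : nat -> R) (b : nat -> nat -> R).
Hypothesis w_ge0 : forall k, 0 <= w k.
Hypothesis b_ge0 : forall i j, 0 <= b i j.
Hypothesis w_step : forall k, (K <= k)%N -> w k.+1 * q + gamma k <= w k.
Hypothesis b_column : forall j N, \sum_(K <= i < N) w i.+1 * b i j <= gamma j.

(** Besides the weighted current value w k * u k, the functional holds for every
    past time j the reserve gamma j * u j, set aside for all the later times at
    which the delay will call on u j, minus what has been called since time K. *)
Definition lyapunov (u : nat -> R) (k : nat) : R :=
  w k * u k + \sum_(j < k) gamma j * u j
  - \sum_(K <= i < k) w i.+1 * \sum_(j < i.+1) b i j * u j.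

(** The delayed terms of the recursion are paid out of the reserve, so only the
    instantaneous part and the new reserve gamma k have to fit into w k. *)
Lemma lyapunov_step u k : (K <= k)%N -> 0 <= u k ->
  u k.+1 <= q * u k + \sum_(j < k.+1) b k j * u j ->
  lyapunov u k.+1 <= lyapunov u k.
Proof.
move=> Kk uk0 h; rewrite /lyapunov big_ord_recr/= big_nat_recr//=.
set s1 := \sum_(j < k) _; set s2 := \sum_(K <= i < k) _.
set s3 := \sum_(j < k.+1) _ in h *.
have := ler_wpM2l (w_ge0 k.+1) h.
have := ler_wpM2r uk0 (w_step Kk).
rewrite mulrDl mulrDr; lra.
Qed.

(** The reserve never runs out: exchanging the two sums, what has been called on
    u j is a partial column sum of the coefficients b, at most gamma j. *)
Lemma lyapunov_ge u k : (forall j, 0 <= u j) -> w k * u k <= lyapunov u k.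
Proof.
move=> u0; rewrite /lyapunov -addrA lerDl subr_ge0.
apply: (@le_trans _ _ (\sum_(K <= i < k) \sum_(j < k) w i.+1 * b i j * u j)).
  apply: ler_sum_nat => i /andP[_ ik]; rewrite mulr_sumr.
  rewrite (big_ord_widen k (fun j => w i.+1 * (b i j * u j)))//.
  rewrite big_mkcond/=; apply: ler_sum => j _; rewrite mulrA.
  by case: ifP => // _; rewrite !mulr_ge0.
rewrite exchange_big/=; apply: ler_sum => j _.
by rewrite -mulr_suml ler_wpM2r.
Qed.

Lemma lyapunovZ c u k : lyapunov (fun j => c * u j) k = c * lyapunov u k.
Proof.
rewrite /lyapunov mulrBr mulrDr; congr (_ + _ - _); first by ring.
  by rewrite mulr_sumr; apply: eq_bigr => j _; ring.
rewrite mulr_sumr; apply: eq_bigr => i _; rewrite mulrCA; congr (_ * _).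
by rewrite mulr_sumr; apply: eq_bigr => j _; ring.
Qed.

Context (disp : measure_display) (Omega : measurableType disp).
Variables (P : probability Omega R) (F : nat -> set (set Omega)).
Hypothesis F_sigma : forall k, sigma_algebra setT (F k).
Hypothesis F_meas : forall k, F k `<=` measurable.
Hypothesis F_mono : forall k, F k `<=` F k.+1.
Variable U : nat -> Omega -> R.
Hypothesis U_ge0 : forall k x, 0 <= U k x.
Hypothesis U_adapted : forall k, measurable_wrt (F k) (U k).
Hypothesis U_int : forall k, P.-integrable setT (EFin \o U k).
Hypothesis U_step : forall k (A : set Omega), F k A ->
  \int[P]_x (\1_A x * U k.+1 x) <= q * \int[P]_x (\1_A x * U k x)
    + \sum_(j < k.+1) b k j * \int[P]_x (\1_A x * U j x).

(** The functional is linear in the sequence, so taking means commutes with it. *)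
Lemma lyapunov_mean (X : nat -> Omega -> R) (m : nat -> R) k :
  (forall j, has_mean P (X j) (m j)) ->
  has_mean P (fun x => lyapunov (X ^~ x) k) (lyapunov m k).
Proof.
move=> h; apply: has_meanB; first apply: has_meanD.
- exact: has_meanZ.
- by apply: has_mean_sum => j; exact: has_meanZ.
- apply: has_mean_sum => i; apply: has_meanZ.
  by apply: has_mean_sum => j; exact: has_meanZ.
Qed.

Let F_mono_le i j : (i <= j)%N -> F i `<=` F j.
Proof.
elim: j => [|j IH]; first by rewrite leqn0 => /eqP ->.
rewrite leq_eqVlt => /predU1P[->//|]; rewrite ltnS => /IH ij.
exact: subset_trans (F_mono (k := j)).
Qed.

Let lyapunov_adapted k : measurable_wrt (F k) (fun x => lyapunov (U ^~ x) k).
Proof.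
have mU j : (j <= k)%N -> measurable_wrt (F k) (U j).
  move=> jk; exact: measurable_wrt_sub (F_sigma j) (F_mono_le jk) (@U_adapted j).
apply: measurable_funB; first apply: measurable_funD.
- by apply: measurable_funM; [exact: measurable_cst|exact: mU].
- apply: measurable_sum => j.
  by apply: measurable_funM; [exact: measurable_cst|apply: mU; exact: ltnW].
- rewrite (_ : (fun x => _) = fun x => \sum_(K <= i < k)
      if (K <= i < k)%N then w i.+1 * \sum_(j < i.+1) b i j * U j x else 0).
    apply: measurable_sum => i.
    have [/andP[_ ik]|_] := boolP (K <= i < k)%N; last exact: measurable_cst.
    apply: measurable_funM; first exact: measurable_cst.
    apply: measurable_sum => j; apply: measurable_funM; first exact: measurable_cst.
    by apply: mU; rewrite -ltnS (leq_trans (ltn_ord j))// ltnW.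
  by apply/funext => x; apply: eq_big_nat => i ->.
Qed.

Let V m (x : Omega) := lyapunov (U ^~ x) (K + m).

Let V_step m (A : set Omega) : F (K + m) A ->
  \int[P]_x (\1_A x * V m.+1 x) <= \int[P]_x (\1_A x * V m x).
Proof.
move=> FA; have mA := F_meas FA.
pose u j := \int[P]_x (\1_A x * U j x).
have hu j : has_mean P (fun x => \1_A x * U j x) (u j).
  by apply: has_mean_intro; exact: integrable_indicM.
have E k : \int[P]_x (\1_A x * lyapunov (U ^~ x) k) = lyapunov u k.
  have [_ <-] := lyapunov_mean k hu.
  by apply: eq_Rintegral => x _; rewrite lyapunovZ.
rewrite /V !E addnS; apply: lyapunov_step; first exact: leq_addr.
- by apply: Rintegral_ge0 => x _; rewrite mulr_ge0// indicE.
- exact: U_step.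
Qed.

Let V_int m : P.-integrable setT (EFin \o V m).
Proof. by case: (lyapunov_mean (K + m) (fun j => has_mean_intro (U_int j))). Qed.

Let V_ge m x : w (K + m) * U (K + m) x <= V m x.
Proof. by apply: (lyapunov_ge _ (u := U ^~ x)). Qed.

Let V_ge0 m x : 0 <= V m x.
Proof. by apply: le_trans (V_ge m x); rewrite mulr_ge0. Qed.

Lemma lyapunov_mean_bounded :
  exists C, forall k, (K <= k)%N -> w k * \int[P]_x U k x <= C.
Proof.
exists (\int[P]_x V 0%N x) => k /subnKC <-.
have sup := @supermartingale_mean_le _ _ _ P (fun m => F (K + m))
  (fun m => F_sigma (K + m)) V V_step (k - K)%N.
apply: le_trans sup.
have [iX <-] := has_meanZ (w (K + (k - K))) (has_mean_intro (U_int (K + (k - K)))).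
exact: le_Rintegral.
Qed.

Lemma lyapunov_bounded_ae :
  {ae P, forall x, exists C, forall k, (K <= k)%N -> w k * U k x <= C}.
Proof.
have mono m : F (K + m) `<=` F (K + m.+1) by rewrite addnS; exact: F_mono.
have := @supermartingale_bounded_ae _ _ _ P (fun m => F (K + m))
  (fun m => F_sigma (K + m)) (fun m => @F_meas (K + m)) mono V V_ge0
  (fun m => @lyapunov_adapted (K + m)) V_int V_step.
apply: filterS => x [C VC]; exists C => k /subnKC <-.
exact: le_trans (V_ge _ _) (VC _).
Qed.
End lyapunov.

(** * Linear interpolation and the weights of the delay *)

Section interpolation.
Local Open Scope classical_set_scope.
Local Open Scope ring_scope.
Variable R : realType.

(** The hat function of piecewise linear interpolation: the interpolant of a
    sequence z at x is the sum of tent j x times z j. *)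
Definition tent (j : nat) (x : R) : R := Num.max 0 (1 - `|x - j%:R|).

Lemma tent_ge0 j x : 0 <= tent j x.
Proof. by rewrite le_max lexx. Qed.

Lemma tent_le1 j x : tent j x <= 1.
Proof. by rewrite ge_max ler01 gerBl normr_ge0. Qed.

Lemma tent_gt0 j x : 0 < tent j x -> j%:R - 1 < x < j%:R + 1.
Proof. by rewrite lt_max ltxx/= subr_gt0 ltr_distl. Qed.

Lemma tent_continuous j (c : R) : continuous (fun u : R => tent j (u * c)).
Proof.
move=> u; apply: (@continuous_max _ R _ _ u); first exact: cst_continuous.
apply: cvgB; first exact: cst_continuous.
apply: cvg_norm; apply: cvgB; last exact: cst_continuous.
by apply: cvgMr_tmp; exact: id.
Qed.

Lemma linterpE n (D : R) (z : nat -> 'cV[R]_n) (x : R) : D != 0 ->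
  linterp D z (x * D) =
  (1 - (x - (Num.truncn x)%:R)) *: z (Num.truncn x)
  + (x - (Num.truncn x)%:R) *: z (Num.truncn x).+1.
Proof.
move=> D0; rewrite /linterp mulfK// -!mulrBl !mulfK//.
by congr (_ *: _ + _); rewrite -natr1; ring.
Qed.

Lemma linterpB n (D : R) (z z' : nat -> 'cV[R]_n) (x : R) :
  linterp D z x - linterp D z' x = linterp D (fun j => z j - z' j) x.
Proof. by rewrite /linterp !scalerBr opprD addrACA. Qed.

(** On [m, m + 1] the interpolant is a convex combination of z m and z m.+1 with
    weights tent m x and tent m.+1 x, and the squared norm is convex. The values
    of z beyond k do not occur since x <= k. *)
Lemma linterp_convex n (D : R) (z : nat -> 'cV[R]_n) (k : nat) (x : R) :
  D != 0 -> 0 <= x -> x <= k%:R ->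
  enorm (linterp D z (x * D)) ^+ 2
  <= \sum_(j < k.+1) tent j x * enorm (z j) ^+ 2.
Proof.
move=> D0 x0 xk; rewrite linterpE//; set m := Num.truncn x.
have mx : m%:R <= x by rewrite /m truncn_le.
have xm : x < m.+1%:R by rewrite /m truncnS_gt.
have T0 j : 0 <= tent j x * enorm (z j) ^+ 2 by rewrite mulr_ge0 ?tent_ge0 ?sqr_ge0.
have r01 : 0 <= x - m%:R <= 1 by rewrite -natr1 in xm; apply/andP; split; lra.
have t1 : 1 - (x - m%:R) = tent m x.
  by rewrite /tent ger0_norm ?subr_ge0// max_r//; lra.
have mk : (m < k.+1)%N by rewrite ltnS -(ler_nat R) (le_trans mx).
apply: le_trans (enorm2_convex _ _ r01) _; rewrite t1.
rewrite (bigD1 (Ordinal mk))//= lerD2l.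
have mk2 : (m <= k)%N by rewrite -ltnS.
move: mk2; rewrite leq_eqVlt => /predU1P[mkE|mk'].
  (* here m = k, so x = k sits on the last node *)
  have -> : x - m%:R = 0 by apply/eqP; rewrite subr_eq0 eq_le mx mkE xk.
  by rewrite mul0r sumr_ge0.
rewrite (bigD1 (Ordinal (mk' : m.+1 < k.+1)%N))/=; last first.
  by apply/eqP => /(congr1 val)/= /eqP; rewrite eqn_leq ltnn.
have -> : x - m%:R = tent m.+1 x.
  by rewrite /tent distrC ger0_norm ?subr_ge0 ?ltW// -natr1 max_r//; rewrite -natr1 in xm; lra.
by rewrite lerDl sumr_ge0.
Qed.

Lemma ev_EMseg (a D : R) n (z : nat -> 'cV[R]_n) k u : a <= u <= 1 ->
  ev (EMseg a D z k) u = linterp D z (u * k%:R * D).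
Proof.
move=> u1; rewrite /ev.
have /(congr1 (fun F => F (fun t : R => linterp D z (t * k%:R * D)) u)) :=
  @sigLK _ _ (0 : 'cV[R]_n) `[a, 1].
by move=> /=; rewrite {1}/patch mem_set /=; [exact|rewrite in_itv].
Qed.

Lemma ev_Cseg0 (a : R) n u : ev (Cseg0 a n) u = 0.
Proof. by rewrite /ev /valL_/=; case: ('oinv_set_val u). Qed.

Lemma count_window (M a K N : nat) :
  (\sum_(K <= i < N) ((a <= i) && (i < a + M) : nat) <= M)%N.
Proof.
have : (\sum_(K <= i < N) ((a <= i) && (i < a + M) : nat) <= minn M (N - a))%N.
  elim: N => [|N IH]; first by rewrite big_geq.
  have [KN|NK] := leqP K N; last by rewrite big_geq.
  rewrite big_nat_recr//=; have [aN|Na] := leqP a N => /=; last first.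
    by rewrite addn0 (leq_trans IH)// leq_min !geq_min leqnn/= leq_sub2r ?orbT.
  have [NM|MN] := ltnP N (a + M).
    rewrite addn1 leq_min subSn// ltnS (leq_trans IH) ?geq_minr// andbT.
    rewrite (leq_ltn_trans IH)// (leq_ltn_trans (geq_minr _ _))//.
    by rewrite ltn_subLR.
  by rewrite addn0 (leq_trans IH)// leq_min !geq_min leqnn/= leq_sub2r ?orbT.
by move/leq_trans; apply; exact: geq_minl.
Qed.

(** The tent at j is positive only on an interval of length 2, and the points u i
    are u-separated: at most M of them fall inside. *)
Lemma tent_column (M j K N : nat) (u C : R) (w : nat -> R) :
  0 < u -> 2 <= M%:R * u -> 0 <= C -> (forall i, 0 <= w i) ->
  (forall i, u * i%:R < j%:R + 1 -> w i <= C) ->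
  \sum_(K <= i < N) w i * tent j (u * i%:R) <= M%:R * C.
Proof.
move=> u0 Mu C0 w0 wC.
pose Q i := 0 < tent j (u * i%:R).
have [/asboolP exQ|/asboolP nQ] := boolP `[< exists i, Q i >]; last first.
  rewrite big1 ?mulr_ge0// => i _.
  suff -> : tent j (u * i%:R) = 0 by rewrite mulr0.
  apply/eqP; rewrite eq_le tent_ge0 andbT leNgt; apply/negP => t.
  by apply: nQ; exists i.
have [a Qa amin] := ex_minnP exQ.
have Qwin i : Q i -> (a <= i < a + M)%N.
  move=> Qi; rewrite amin//= -(ltr_nat R) natrD.
  have /andP[ja _] := tent_gt0 Qa; have /andP[_ ij] := tent_gt0 Qi.
  by rewrite -(ltr_pM2l u0) mulrDr; rewrite mulrC in Mu; lra.
apply: (@le_trans _ _ (\sum_(K <= i < N) ((a <= i < a + M)%N : nat)%:R * C)).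
  apply: ler_sum => i _; have [Qi|] := boolP (Q i).
    rewrite Qwin// mul1r; have /andP[_ ij] := tent_gt0 Qi.
    by apply: le_trans (wC _ ij); rewrite ler_piMr ?tent_le1.
  rewrite /Q -leNgt => t0.
  have -> : tent j (u * i%:R) = 0 by apply/eqP; rewrite eq_le tent_ge0 t0.
  by rewrite mulr0 mulr_ge0.
rewrite -mulr_suml ler_wpM2r// -natr_sum ler_nat; exact: count_window.
Qed.

Section coefficients.
Variables (nu : probability (measurableTypeR R) R) (a b : R).

(** How much the delay measure nu makes time k depend on the value at time j. *)
Definition delay_coef (k j : nat) : R :=
  \int[nu]_(u in `[a, b]) tent j (u * k%:R).

Let mI : measurable (`[a, b] : set (measurableTypeR R)).
Proof. exact: measurable_itv. Qed.

Let integrable_cont (h : R -> R) : continuous h ->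
  nu.-integrable `[a, b] (EFin \o h).
Proof.
move=> ch; apply: measurable_bounded_integrable => //.
- by rewrite (le_lt_trans (probability_le1 _ _))// ltry.
- by apply: measurable_funTS; exact: continuous_measurable_fun.
- have /compact_bounded := continuous_compact (continuous_subspaceT ch) (@segment_compact _ a b).
  move=> [M [_ hM]]; exists M; split; first exact: num_real.
  by move=> y My x abx; apply: hM My _ _; exists x.
Qed.

Lemma delay_coef_ge0 k j : 0 <= delay_coef k j.
Proof. by apply: Rintegral_ge0 => u _; exact: tent_ge0. Qed.

Let integral_lin (I : Type) (r : seq I) (c : I -> R) (h : I -> R -> R) :
  (forall i, continuous (h i)) ->
  nu.-integrable `[a, b] (EFin \o (fun u => \sum_(i <- r) c i * h i u)) /\
  \int[nu]_(u in `[a, b]) (\sum_(i <- r) c i * h i u) =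
  \sum_(i <- r) c i * \int[nu]_(u in `[a, b]) h i u.
Proof.
move=> ch; elim: r => [|i r [iS ES]].
  split; last first.
    by rewrite big_nil; under eq_Rintegral do rewrite big_nil; rewrite Rintegral_cst ?mul0r.
  by apply: (eq_integrable _ (fun=> 0%E)) => [|u _|]//=; [rewrite big_nil|exact: integrable0].
have iZ : nu.-integrable `[a, b] (EFin \o (fun u => c i * h i u)).
  have := integrableZl mI (c i) (integrable_cont (ch i)).
  exact: eq_integrable.
have E : (fun u => \sum_(j <- i :: r) c j * h j u) =
    fun u => c i * h i u + \sum_(j <- r) c j * h j u.
  by apply/funext => u; rewrite big_cons.
rewrite E big_cons; split.
  by have := integrableD mI iZ iS; exact: eq_integrable.
rewrite RintegralD// ES RintegralZl//; exact: integrable_cont.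
Qed.

(** The bound of [tent_column] holds for every delay u >= a; integrate it. *)
Lemma delay_coef_column (M j K N : nat) (C : R) (w : nat -> R) :
  0 < a -> 2 <= M%:R * a -> 0 <= C -> (forall i, 0 <= w i) ->
  (forall i, a * i%:R < j%:R + 1 -> w i <= C) ->
  \sum_(K <= i < N) w i * delay_coef i j <= M%:R * C.
Proof.
move=> a0 Ma C0 w0 wC.
have tc i : continuous (fun u : R => tent j (u * i%:R)) by exact: tent_continuous.
have [iS <-] := integral_lin (index_iota K N) w tc.
apply: (@le_trans _ _ (\int[nu]_(u in `[a, b]) (M%:R * C))).
  apply: le_Rintegral => //; first exact: finite_measure_integrable_cst.
  move=> u; rewrite /= in_itv/= => /andP[au _].
  have u0 : 0 < u by exact: lt_le_trans au.
  apply: tent_column => //; first by rewrite (le_trans Ma)// ler_wpM2l.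
  by move=> i ui; apply: wC; apply: le_lt_trans ui; rewrite ler_wpM2r.
rewrite Rintegral_cst//= ler_piMr ?mulr_ge0//.
by rewrite -lee_fin fineK ?fin_num_measure//; exact: probability_le1.
Qed.

Lemma integral_linterp n (D : R) (z : nat -> 'cV[R]_n) (k : nat) :
  D != 0 -> 0 <= a -> b <= 1 ->
  \int[nu]_(u in `[a, b]) (enorm (linterp D z (u * k%:R * D)) ^+ 2)
  <= \sum_(j < k.+1) delay_coef k j * enorm (z j) ^+ 2.
Proof.
move=> D0 a0 b1.
have cl : continuous (fun u : R => enorm (linterp D z (u * k%:R * D)) ^+ 2).
  rewrite (_ : (fun u => _) = fun u => \sum_(i < n) (linterp D z (u * k%:R * D) i ord0) ^+ 2).
    move=> u; apply: cvg_big; first exact: add_continuous.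
    move=> i _.
    have ci : {for u, continuous (fun u : R => linterp D z (u * k%:R * D) i ord0)}.
      apply: (@continuous_comp _ _ _ (fun u : R => linterp D z (u * k%:R * D))
        (fun M : 'cV[R]_n => M i ord0)); first exact: linterp_continuous.
      exact: coord_continuous.
    exact: (cvgM ci ci).
  by apply/funext => u; rewrite enorm2E; apply: eq_bigr => i _; rewrite big_ord1.
have tc (i : 'I_k.+1) : continuous (fun u : R => tent i (u * k%:R)) by exact: tent_continuous.
have [iS ES] := integral_lin (index_enum 'I_k.+1) (fun i => enorm (z i) ^+ 2) tc.
under eq_bigr do rewrite mulrC; rewrite -ES.
apply: le_Rintegral => //; first exact: integrable_cont.
move=> u; rewrite /= in_itv/= => /andP[au ub].
under eq_bigr do rewrite mulrC; apply: linterp_convex => //.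
  by rewrite mulr_ge0// (le_trans a0).
by rewrite ler_piMl// (le_trans ub).
Qed.

End coefficients.
End interpolation.

(** * Measurability, weights and logarithmic rates *)

Section lipschitz.
Local Open Scope classical_set_scope.
Local Open Scope ring_scope.

(** A Lipschitz function is the infimum over the rational points r of
    Phi(r) + L |x - r|_1, so its strict sublevel sets are countable unions of
    sublevel sets of functions that are visibly measurable. *)
Lemma measurable_lipschitz (R : realType) (disp : measure_display)
    (T : measurableType disp) (I : finType) (X : I -> T -> R)
    (Phi : (I -> R) -> R) (L : R) :
  (forall i, measurable_fun setT (X i)) -> 0 <= L ->
  (forall x x', `|Phi x - Phi x'| <= L * \sum_i `|x i - x' i|) ->
  measurable_fun setT (fun t => Phi (X ^~ t)).
Proof.
move=> mX L0 lip.
pose S (c : R) (r : {ffun I -> rat}) := [set t |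
  Phi (fun i => ratr (r i)) + L * \sum_i `|X i t - ratr (r i)| < c].
move=> mT; apply: (measurability _ (RGenInftyO.measurableE R)) => //.
move=> _ [_ [c ->] <-]; rewrite setTI.
have -> : (fun t => Phi (X ^~ t)) @^-1` `]-oo, c[ = \bigcup_r S c r.
  apply/seteqP; split => t /=; rewrite in_itv/=; last first.
    move=> [r _]; apply: le_lt_trans; rewrite -lerBlDl.
    by apply: le_trans (lip _ _); exact: ler_norm.
  (* e is small enough that moving every coordinate by e changes
     Phi(r) + L |x - r|_1 by less than the gap c - Phi(x) *)
  move=> tc; pose e := (c - Phi (X ^~ t)) / (2 * L * #|I|%:R + 1).
  have den : 0 < 2 * L * #|I|%:R + 1 by rewrite ltr_wpDl// !mulr_ge0.
  have e0 : 0 < e by rewrite divr_gt0// subr_gt0.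
  have rP i : exists r : rat, `|X i t - ratr r| <= e.
    have /rat_in_itvoo [r] : X i t < X i t + e by rewrite ltrDl.
    rewrite in_itv/= => /andP[a b]; exists r.
    by rewrite ler_norml; apply/andP; split; lra.
  pose r := [ffun i => sval (cid (rP i))]; exists r => //; rewrite /S/=.
  have re i : `|X i t - ratr (r i)| <= e by rewrite ffunE; case: cid.
  have se : \sum_i `|X i t - ratr (r i)| <= #|I|%:R * e.
    rewrite -sum1_card natr_sum mulr_suml; apply: ler_sum => i _.
    by rewrite mul1r.
  have h := le_trans (ler_norm _) (lip (fun i => ratr (r i)) (X ^~ t)).
  have sE : \sum_i `|ratr (r i) - X i t| = \sum_i `|X i t - ratr (r i)|.
    by apply: eq_bigr => i _; rewrite distrC.
  rewrite sE in h; set s := \sum_i _ in se h *.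
  have Ls : L * s <= L * (#|I|%:R * e) by rewrite ler_wpM2l.
  have eE : e * (2 * L * #|I|%:R + 1) = c - Phi (X ^~ t).
    by rewrite /e divfK// gt_eqF.
  have : 2 * (L * (#|I|%:R * e)) < c - Phi (X ^~ t).
    by rewrite -eE mulrDr mulr1 -subr_gt0; rewrite (_ : _ - _ = e)//; ring.
  lra.
apply: countable_bigcupT_measurable => // r.
have mS : measurable_fun setT (fun t =>
    Phi (fun i => ratr (r i)) + L * \sum_i `|X i t - ratr (r i)|).
  apply: measurable_funD; first exact: measurable_cst.
  apply: measurable_funM; first exact: measurable_cst.
  apply: measurable_sum => i; apply: measurableT_comp => //.
  by apply: measurable_funB => //; exact: measurable_cst.
by have := mS measurableT _ (measurable_itv `]-oo, c[); rewrite setTI set_itvNyo.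
Qed.

End lipschitz.

Section rates.
Local Open Scope classical_set_scope.
Local Open Scope ring_scope.
Variable R : realType.

Lemma powR_continuous_at (z a : R) : 0 < a -> {for a, continuous (fun x : R => x `^ z)}.
Proof.
move=> a0; apply/differentiable_continuous/derivable1_diffP.
by apply: derivable_powR; rewrite in_itv/= a0.
Qed.

(** Divided by (k + 1)^z, the left side converges to q + beta th^(-z). *)
Lemma weights_eventually (z q beta th : R) : 0 < th ->
  q + beta * th `^ (- z) < 1 ->
  exists K : nat, forall k : nat, (K <= k)%N ->
    k.+2%:R `^ z * q + beta * (k.+1%:R / th + 2) `^ z <= k.+1%:R `^ z.
Proof.
move=> th0 hq.
have harm : (@harmonic R) @ \oo --> (0 : R) by exact: cvg_harmonic.
have c1 : (fun k => (1 + harmonic k) `^ z : R) @ \oo --> (1 `^ z : R).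
  apply: (@continuous_cvg nat R R \oo _ (fun k => 1 + harmonic k) (fun x : R => x `^ z) 1).
    exact: powR_continuous_at.
  by rewrite -[X in _ --> X](addr0 1); apply: cvgD => //; exact: cvg_cst.
have c2 : (fun k => (th^-1 + 2 * harmonic k) `^ z : R) @ \oo --> (th `^ (- z) : R).
  have -> : th `^ (- z) = th^-1 `^ z.
    by rewrite -(powR_inv1 (ltW th0)) -powRrM mulN1r.
  apply: (@continuous_cvg nat R R \oo _ (fun k => th^-1 + 2 * harmonic k)
    (fun x : R => x `^ z) th^-1).
    by apply: powR_continuous_at; rewrite invr_gt0.
  rewrite -[X in _ --> X]addr0; apply: cvgD; first exact: cvg_cst.
  by rewrite -[X in _ --> X](mulr0 2); apply: cvgMl_tmp.
have c3 : (fun k => (1 + harmonic k) `^ z * q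
    + beta * (th^-1 + 2 * harmonic k) `^ z : R) @ \oo --> (1 `^ z * q + beta * th `^ (- z) : R).
  apply: cvgD; first by apply: cvgMr_tmp.
  by apply: cvgMl_tmp.
rewrite powR1 mul1r in c3.
have [K _ HK] := cvgr_lt _ c3 _ hq.
exists K => k Kk; have := HK k Kk => /= hk.
have k1 : 0 < (k.+1%:R : R) by rewrite ltr0n.
have E1 : (k.+2%:R : R) = k.+1%:R * (1 + harmonic k).
  by rewrite /harmonic/= -[k.+2%:R]natr1; field; rewrite gt_eqF.
have E2 : (k.+1%:R / th + 2 : R) = k.+1%:R * (th^-1 + 2 * harmonic k).
  by rewrite /harmonic/=; field; rewrite !gt_eqF.
have h0 : 0 <= @harmonic R k by rewrite /harmonic/= invr_ge0.
have t0 : 0 <= th^-1 by rewrite invr_ge0 ltW.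
rewrite E1 E2 !powRM ?addr_ge0 ?mulr_ge0 ?(ltW k1)//.
rewrite -[leRHS]mulr1 -mulrA [beta * _]mulrCA -mulrDr.
by rewrite ler_wpM2l ?powR_ge0// ltW.
Qed.

Lemma limn_esup_le_near (u : (\bar R)^nat) (x : \bar R) (N : nat) :
  (forall k, (N <= k)%N -> (u k <= x)%E) -> (limn_esup u <= x)%E.
Proof.
move=> h; rewrite /limn_esup/limf_esup.
apply: (@le_trans _ _ (ereal_sup (u @` [set k | (N <= k)%N]))).
  by apply: ereal_inf_lbound; exists [set k | (N <= k)%N] => //; exists N.
by apply: ge_ereal_sup => _ [k /= Nk <-]; exact: h.
Qed.

(** The logarithm of the bound is ln C - z ln (k + 1); the constants ln C and ln D
    are eventually smaller than e ln (k + 1). Zero values of a have logarithm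
    minus infinity and cause no harm. *)
Lemma limn_esup_rate (a : nat -> R) (z e D C : R) (K : nat) :
  0 < D -> 0 < e -> (forall k, 0 <= a k) ->
  (forall k, (K <= k)%N -> k.+1%:R `^ z * a k <= C) ->
  (limn_esup (fun k => lne (a k)%:E / (ln `|k.+1%:R * D|)%:E)
    <= (- z + e)%:E)%E.
Proof.
move=> D0 e0 a0 aC.
pose C1 := Num.max C 1.
have C10 : 0 < C1 by rewrite lt_max ltr01 orbT.
(* beyond X, ln ((k + 1) D) is positive and e ln (k + 1) outweighs the
   constants *)
pose X := Num.max (- ln D) ((ln C1 + (z - e) * ln D) / e).
apply: (@limn_esup_le_near _ _ (maxn K (Num.truncn (expR X)))) => k.
rewrite geq_max => /andP[Kk Xk].
have k1 : 0 < (k.+1%:R : R) by rewrite ltr0n.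
have lX : X < ln (k.+1%:R : R).
  rewrite -[X in X < _]expRK ltr_ln ?posrE ?expR_gt0//.
  by rewrite (lt_le_trans (truncnS_gt _))// ler_nat.
rewrite ger0_norm ?mulr_ge0 ?(ltW D0)// lnM ?posrE//.
set l := ln (k.+1%:R : R) in lX *.
have lD : 0 < l + ln D.
  by have : - ln D <= X by [rewrite le_max lexx]; lra.
have le : ln C1 + (z - e) * ln D <= e * l.
  have : (ln C1 + (z - e) * ln D) / e <= X by rewrite le_max lexx orbT.
  move=> /le_lt_trans/(_ lX); rewrite ltr_pdivrMr// [l * e]mulrC; exact: ltW.
have inv : ((l + ln D)%:E^-1 = ((l + ln D)^-1)%:E)%E by rewrite inver gt_eqF.
have := a0 k; rewrite le_eqVlt => /predU1P[<-|ak].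
  rewrite le0_lneNy// inv mulNyr gtr0_sg ?invr_gt0// mul1e; exact: leNye.
rewrite lne_EFin// inv -EFinM lee_fin ler_pdivrMr//.
have := aC k Kk => h.
have : ln (k.+1%:R `^ z * a k) <= ln C1.
  rewrite ler_ln ?posrE ?mulr_gt0 ?powR_gt0//.
  by rewrite (le_trans h)// le_max lexx.
rewrite lnM ?posrE ?powR_gt0// ln_powR -/l; lra.
Qed.

End rates.

(** * The coefficients along an interpolated path *)

Section scheme_coefficient.
Local Open Scope classical_set_scope.
Local Open Scope ring_scope.
Variables (R : realType) (th thb D : R) (n : nat).
Hypotheses (th_ge0 : 0 <= th) (th_thb : th <= thb) (thb_le1 : thb <= 1) (D0 : D != 0).

(** Both the segment of the scheme and the zero function interpolate a sequence;
    treating them alike turns the hypotheses on differences into bounds for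
    single segments. *)
Definition interpolates (k : nat) (phi : Cseg th n) (z : nat -> 'cV[R]_n) :=
  forall u : R, th <= u <= 1 -> ev phi u = linterp D z (u * k%:R * D).

Lemma EMseg_interpolates k z : interpolates k (EMseg th D z k) z.
Proof. by move=> u; exact: ev_EMseg. Qed.

Lemma Cseg0_interpolates k : interpolates k (Cseg0 th n) (fun=> 0).
Proof. by move=> u _; rewrite ev_Cseg0 /linterp !scaler0 addr0. Qed.

Lemma interpolates1 k phi z : interpolates k phi z -> ev phi 1 = z k.
Proof.
move=> /(_ 1) ->; last by rewrite lexx andbT (le_trans th_thb).
rewrite mul1r linterpE// natrK subrr scale0r addr0 subr0 scale1r//.
Qed.

Lemma integral_interpolates (nu : probability (measurableTypeR R) R)
    k phi psi z z' : interpolates k phi z -> interpolates k psi z' ->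
  \int[nu]_(u in `[th, thb]) (enorm (ev phi u - ev psi u) ^+ 2)
  <= \sum_(j < k.+1) delay_coef nu th thb k j * enorm (z j - z' j) ^+ 2.
Proof.
move=> hz hz'; apply: le_trans (integral_linterp nu (fun j => z j - z' j) k D0 th_ge0 thb_le1).
rewrite le_eqVlt; apply/orP; left; apply/eqP; apply: eq_Rintegral => u.
rewrite inE/= in_itv/= => /andP[u1 u2].
have u12 : th <= u <= 1 by rewrite u1 (le_trans u2).
by rewrite (hz _ u12) (hz' _ u12) linterpB.
Qed.

Variables (m : nat) (h : Cseg th n -> 'M[R]_(n, m)).
Variables (nu : probability (measurableTypeR R) R) (l3 l4 : R).
Hypotheses (l3_ge0 : 0 <= l3) (l4_ge0 : 0 <= l4).
Hypothesis h_lip : forall phi psi : Cseg th n,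
  enorm (h phi - h psi) ^+ 2 <= l3 * enorm (ev phi 1 - ev psi 1) ^+ 2
    + l4 * \int[nu]_(u in `[th, thb]) (enorm (ev phi u - ev psi u) ^+ 2).

Lemma coefficient_lip k phi psi z z' :
  interpolates k phi z -> interpolates k psi z' ->
  enorm (h phi - h psi) ^+ 2 <= l3 * enorm (z k - z' k) ^+ 2
    + l4 * \sum_(j < k.+1) delay_coef nu th thb k j * enorm (z j - z' j) ^+ 2.
Proof.
move=> hz hz'; apply: le_trans (h_lip phi psi) _.
rewrite (interpolates1 hz) (interpolates1 hz') lerD2l ler_wpM2l//.
exact: integral_interpolates.
Qed.

Lemma coefficient_growth k phi z : h (Cseg0 th n) = 0 -> interpolates k phi z ->
  enorm (h phi) ^+ 2 <= l3 * enorm (z k) ^+ 2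
    + l4 * \sum_(j < k.+1) delay_coef nu th thb k j * enorm (z j) ^+ 2.
Proof.
move=> h0 hz; have := coefficient_lip hz (Cseg0_interpolates k).
by rewrite h0 !subr0; under eq_bigr do rewrite subr0.
Qed.

Lemma enorm2_le_sum p (u : 'cV[R]_p) : enorm u ^+ 2 <= (\sum_i `|u i ord0|) ^+ 2.
Proof.
rewrite enorm2E expr2 mulr_suml; apply: ler_sum => i _.
rewrite big_ord1 -(real_normK (num_real _)) expr2 ler_wpM2l//.
by rewrite (bigD1 i)//= lerDl sumr_ge0.
Qed.

(** The coefficient is a Lipschitz function of the finitely many coordinates of
    Y 0, ..., Y k, since the segment depends on no later value. *)
Lemma coefficient_measurable (disp : measure_display) (T : measurableType disp)
    (Y : nat -> T -> 'cV[R]_n) k :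
  (forall j a, (j <= k)%N -> measurable_fun setT (fun t => Y j t a ord0)) ->
  forall a i, measurable_fun setT (fun t => h (EMseg th D (Y ^~ t) k) a i).
Proof.
move=> mY a i.
(* mk x rebuilds a sequence from the coordinates; its values after k are junk
   that the segment at k ignores *)
pose mk (x : 'I_k.+1 * 'I_n -> R) (j : nat) : 'cV[R]_n := \col_c x (inord j, c).
pose Phi x := h (EMseg th D (mk x) k) a i.
pose X (p : 'I_k.+1 * 'I_n) (t : T) : R := Y p.1 t p.2 ord0.
(* the Lipschitz bound vanishes when two sequences agree up to time k *)
have -> : (fun t => h (EMseg th D (Y ^~ t) k) a i) = fun t => Phi (X ^~ t).
  apply/funext => t.
  have E j : (j <= k)%N -> Y j t = mk (X ^~ t) j.
    move=> jk; apply/matrixP => c o; rewrite mxE /X/= inordK ?ltnS//.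
    by rewrite (ord1 o).
  have := coefficient_lip (EMseg_interpolates k (Y ^~ t)) (EMseg_interpolates k (mk (X ^~ t))).
  rewrite E// subrr enorm20 mulr0 add0r big1 ?mulr0; last first.
    by move=> j _; rewrite E ?subrr ?enorm20 ?mulr0// -ltnS.
  move=> le0; apply/eqP; rewrite -subr_eq0 -sqrf_eq0 eq_le sqr_ge0 andbT.
  apply: le_trans le0.
  have := entry_le_enorm2
    (h (EMseg th D (Y ^~ t) k) - h (EMseg th D (mk (X ^~ t)) k)) a i.
  by rewrite !mxE.
pose L2 := l3 + l4 * \sum_(j < k.+1) delay_coef nu th thb k j.
have L20 : 0 <= L2.
  by rewrite addr_ge0// mulr_ge0// sumr_ge0// => j _; exact: delay_coef_ge0.
apply: (@measurable_lipschitz R _ T _ X Phi (Num.sqrt L2)).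
- by move=> [j c]; apply: mY; rewrite -ltnS.
- exact: sqrtr_ge0.
move=> x x'; set S := \sum_p _.
have S0 : 0 <= S by rewrite sumr_ge0.
have le1 (j : nat) : (j <= k)%N -> enorm (mk x j - mk x' j) ^+ 2 <= S ^+ 2.
  move=> jk; apply: le_trans (enorm2_le_sum _) _.
  rewrite ler_sqr ?nnegrE ?sumr_ge0//.
  have -> : S = \sum_j \sum_c `|x (j, c) - x' (j, c)|.
    by rewrite pair_bigA; apply: eq_bigr => -[].
  rewrite (bigD1 (inord j))//=; under eq_bigr do rewrite !mxE.
  by rewrite lerDl sumr_ge0// => j' _; rewrite sumr_ge0.
rewrite -[leLHS]sqrtr_sqr -[X in _ <= _ * X](ger0_norm S0) -(sqrtr_sqr S) -sqrtrM//.
rewrite ler_sqrt ?mulr_ge0 ?sqr_ge0//.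
have := entry_le_enorm2 (h (EMseg th D (mk x) k) - h (EMseg th D (mk x') k)) a i.
rewrite !mxE => /le_trans; apply.
apply: le_trans (coefficient_lip (EMseg_interpolates k (mk x)) (EMseg_interpolates k (mk x'))) _.
rewrite mulrDl; apply: lerD; first by rewrite ler_wpM2l// le1.
rewrite -mulrA ler_wpM2l// mulr_suml; apply: ler_sum => j _.
by rewrite ler_wpM2l ?delay_coef_ge0// le1// -ltnS.
Qed.

End scheme_coefficient.

(** * Mean-square analysis of the scheme *)

Section scheme.
Local Open Scope classical_set_scope.
Local Open Scope ring_scope.
Context (R : realType) (disp : measure_display) (Omega : measurableType disp).
Variables (P : probability Omega R) (Fil : R -> set (set Omega)).
Variables (n d : nat) (B : R -> Omega -> 'cV[R]_d).
Hypothesis usual : usual_filtration P Fil.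
Hypothesis brownian : brownian_motion P Fil B.
Variables (th thb : R).
Hypotheses (th_gt0 : 0 < th) (th_thb : th <= thb) (thb_le1 : thb <= 1).
Variables (f : Cseg th n -> R -> 'cV[R]_n) (g : Cseg th n -> R -> 'M[R]_(n, d)).
Hypothesis f0 : forall t : R, 0 <= t -> f (Cseg0 th n) t = 0.
Hypothesis g0 : forall t : R, 0 <= t -> g (Cseg0 th n) t = 0.
Variables (l1 l2 l3 l4 : R).
Hypotheses (l2_ge0 : 0 <= l2) (l3_ge0 : 0 <= l3) (l4_ge0 : 0 <= l4).
Variables nu nu' : probability (measurableTypeR R) R.
Hypothesis dissipative : forall (phi psi : Cseg th n) (t : R), 0 <= t ->
  2 * dotv (ev phi 1 - ev psi 1) (f phi t - f psi t)
    + enorm (g phi t - g psi t) ^+ 2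
  <= - l1 * enorm (ev phi 1 - ev psi 1) ^+ 2
    + l2 * \int[nu]_(u in `[th, thb]) (enorm (ev phi u - ev psi u) ^+ 2).
Hypothesis lipschitz : forall (phi psi : Cseg th n) (t : R), 0 <= t ->
  Num.max (enorm (f phi t - f psi t) ^+ 2) (enorm (g phi t - g psi t) ^+ 2)
  <= l3 * enorm (ev phi 1 - ev psi 1) ^+ 2
    + l4 * \int[nu']_(u in `[th, thb]) (enorm (ev phi u - ev psi u) ^+ 2).
Variables (x0 : 'cV[R]_n) (D : R) (y : nat -> Omega -> 'cV[R]_n).
Hypotheses (D_gt0 : 0 < D) (em : EM_scheme f g x0 B D y).

Let F (k : nat) := Fil (k%:R * D).
Let U (k : nat) (w : Omega) := enorm (y k w) ^+ 2.
Let fk k w := f (EMseg th D (y^~ w) k) (k%:R * D).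
Let gk k w := g (EMseg th D (y^~ w) k) (k%:R * D).
Let c1 k j := delay_coef nu th thb k j.
Let c2 k j := delay_coef nu' th thb k j.

(** Weight of U j in the bound for U k.+1: dissipativity enters with the step D,
    the square of the drift D f with D^2. *)
Definition EM_delay_coef k j := D * l2 * c1 k j + D ^+ 2 * l4 * c2 k j.
Definition EM_contraction := 1 - D * l1 + D ^+ 2 * l3.

Let D0 : D != 0. Proof. by rewrite gt_eqF. Qed.
Let th0 : 0 <= th. Proof. exact: ltW. Qed.
Let kD_ge0 (k : nat) : 0 <= k%:R * D. Proof. by rewrite mulr_ge0// ltW. Qed.

Let kD_lt (k : nat) : k%:R * D < k.+1%:R * D.
Proof. by rewrite ltr_pM2r// ltr_nat. Qed.

Let F_sigma k : sigma_algebra setT (F k).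
Proof. exact: (filt_sigma usual). Qed.

Let F_meas k : F k `<=` measurable.
Proof. exact: (filt_meas usual). Qed.

Let F_mono_le i j : (i <= j)%N -> F i `<=` F j.
Proof.
move=> ij; apply: (filt_mono usual); first exact: kD_ge0.
by apply: ler_wpM2r; [exact: ltW|rewrite ler_nat].
Qed.

Let yS k w : y k.+1 w = (y k w + D *: fk k w)
  + gk k w *m (B (k.+1%:R * D) w - B (k%:R * D) w).
Proof. by have [_ ->] := em w. Qed.

Let flip t (t0 : 0 <= t) (phi psi : Cseg th n) :
  enorm (f phi t - f psi t) ^+ 2 <= l3 * enorm (ev phi 1 - ev psi 1) ^+ 2
    + l4 * \int[nu']_(u in `[th, thb]) (enorm (ev phi u - ev psi u) ^+ 2).
Proof. by apply: le_trans (lipschitz _ _ t0); rewrite le_max lexx. Qed.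

Let glip t (t0 : 0 <= t) (phi psi : Cseg th n) :
  enorm (g phi t - g psi t) ^+ 2 <= l3 * enorm (ev phi 1 - ev psi 1) ^+ 2
    + l4 * \int[nu']_(u in `[th, thb]) (enorm (ev phi u - ev psi u) ^+ 2).
Proof. by apply: le_trans (lipschitz _ _ t0); rewrite le_max lexx orbT. Qed.

(** Common bound for |f|^2 and |g|^2 along the scheme, by comparison with zero. *)
Let growth k w := l3 * U k w + l4 * \sum_(j < k.+1) c2 k j * U j w.

Let f_growth k w : enorm (fk k w) ^+ 2 <= growth k w.
Proof.
exact: (coefficient_growth (h := f^~ (k%:R * D)) th0 th_thb thb_le1 D0 l4_ge0
  (flip (kD_ge0 k)) (f0 (kD_ge0 k)) (EMseg_interpolates D k (y ^~ w))).
Qed.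

Let g_growth k w : enorm (gk k w) ^+ 2 <= growth k w.
Proof.
exact: (coefficient_growth (h := g^~ (k%:R * D)) th0 th_thb thb_le1 D0 l4_ge0
  (glip (kD_ge0 k)) (g0 (kD_ge0 k)) (EMseg_interpolates D k (y ^~ w))).
Qed.

Let f_dissipative k w :
  2 * dotv (y k w) (fk k w) + enorm (gk k w) ^+ 2
  <= - l1 * U k w + l2 * \sum_(j < k.+1) c1 k j * U j w.
Proof.
have hz := EMseg_interpolates (th := th) D k (y ^~ w).
have h0 := @Cseg0_interpolates R th D n k.
have := dissipative (EMseg th D (y ^~ w) k) (Cseg0 th n) (kD_ge0 k).
rewrite (f0 (kD_ge0 k)) (g0 (kD_ge0 k)) (interpolates1 th_thb thb_le1 D0 hz).
rewrite (interpolates1 th_thb thb_le1 D0 h0) !subr0 => /le_trans; apply.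
rewrite lerD2l ler_wpM2l//.
apply: le_trans (integral_interpolates th0 thb_le1 D0 nu hz h0) _.
by under eq_bigr do rewrite subr0.
Qed.

Let y_adapted_le k : forall j a, (j <= k)%N ->
  measurable_wrt (F k) (fun w => y j w a ord0).
Proof.
elim: k => [j a|k IH j a].
  rewrite leqn0 => /eqP ->.
  rewrite (_ : (fun w => _) = fun=> x0 a ord0); first exact: measurable_cst.
  by apply/funext => w; have [-> _] := em w.
have kk1 : F k `<=` F k.+1 by exact: F_mono_le.
rewrite leq_eqVlt => /predU1P[->|]; last first.
  rewrite ltnS => jk.
  exact: measurable_wrt_sub (F_sigma k) kk1 (IH _ a jk).
rewrite (_ : (fun w => _) = fun w => y k w a ord0 + D * fk k w a ord0
    + \sum_i gk k w a i * (B (k.+1%:R * D) w - B (k%:R * D) w) i ord0); last first.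
  by apply/funext => w; rewrite yS !mxE.
apply: measurable_funD; first apply: measurable_funD.
- exact: measurable_wrt_sub (F_sigma k) kk1 (IH _ a (leqnn k)).
- apply: measurable_funM; first exact: measurable_cst.
  apply: measurable_wrt_sub (F_sigma k) kk1 _.
  exact: (coefficient_measurable (h := f^~ (k%:R * D)) th0 th_thb thb_le1 D0 l3_ge0 l4_ge0
    (flip (kD_ge0 k)) (T := g_sigma_algebraType (F k)) IH).
- apply: measurable_sum => i; apply: measurable_funM.
    apply: measurable_wrt_sub (F_sigma k) kk1 _.
    exact: (coefficient_measurable (h := g^~ (k%:R * D)) th0 th_thb thb_le1 D0 l3_ge0 l4_ge0
      (glip (kD_ge0 k)) (T := g_sigma_algebraType (F k)) IH).
  exact: (increment_adapted usual brownian (kD_ge0 k) (kD_lt k)).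
Qed.

Let f_adapted k a i : measurable_wrt (F k) (fun w => fk k w a i).
Proof.
exact: (coefficient_measurable (h := f^~ (k%:R * D)) th0 th_thb thb_le1 D0 l3_ge0 l4_ge0
  (flip (kD_ge0 k)) (T := g_sigma_algebraType (F k)) (@y_adapted_le k)).
Qed.

Let g_adapted k a i : measurable_wrt (F k) (fun w => gk k w a i).
Proof.
exact: (coefficient_measurable (h := g^~ (k%:R * D)) th0 th_thb thb_le1 D0 l3_ge0 l4_ge0
  (glip (kD_ge0 k)) (T := g_sigma_algebraType (F k)) (@y_adapted_le k)).
Qed.

Let enorm2_adapted k p m (M : Omega -> 'M[R]_(p, m)) :
  (forall a i, measurable_wrt (F k) (fun w => M w a i)) ->
  measurable_wrt (F k) (fun w => enorm (M w) ^+ 2).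
Proof.
move=> mM; rewrite (_ : (fun w => _) = fun w => \sum_a \sum_i M w a i ^+ 2).
  apply: measurable_sum => a; apply: measurable_sum => i.
  by apply: measurable_funX; exact: mM.
by apply/funext => w; rewrite enorm2E.
Qed.

Let adapted_measurable k (X : Omega -> R) :
  measurable_wrt (F k) X -> measurable_fun setT X.
Proof. exact: measurable_wrt_measurable (F_sigma k) (@F_meas k). Qed.

Let y_entry k a i : measurable_wrt (F k) (fun w => y k w a i).
Proof. by rewrite (ord1 i); exact: y_adapted_le. Qed.

Let U_adapted k : measurable_wrt (F k) (U k).
Proof. by apply: enorm2_adapted => a i; exact: y_entry. Qed.

(** The part of y k.+1 that is known at time k. *)
Let drift k w := y k w + D *: fk k w.

Let drift_adapted k a i : measurable_wrt (F k) (fun w => drift k w a i).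
Proof.
rewrite (_ : (fun w => _) = fun w => y k w a i + D * fk k w a i).
  apply: measurable_funD; first exact: y_entry.
  by apply: measurable_funM; [exact: measurable_cst|exact: f_adapted].
by apply/funext => w; rewrite !mxE.
Qed.

Let integrable_growth k :
  (forall j, (j <= k)%N -> P.-integrable setT (EFin \o U j)) ->
  P.-integrable setT (EFin \o growth k).
Proof.
move=> iU.
have h : has_mean P (growth k) (l3 * \int[P]_w U k w
    + l4 * \sum_(j < k.+1) c2 k j * \int[P]_w U j w).
  apply: has_meanD; first exact/has_meanZ/has_mean_intro/iU.
  apply: has_meanZ; apply: has_mean_sum => j; apply: has_meanZ.
  by apply: has_mean_intro; apply: iU; rewrite -ltnS.
by case: h.
Qed.

Let integrable_drift k :
  (forall j, (j <= k)%N -> P.-integrable setT (EFin \o U j)) ->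
  P.-integrable setT (EFin \o (fun w => enorm (drift k w) ^+ 2)).
Proof.
move=> iU; have ig := integrable_growth iU.
have h := has_meanD (has_meanZ 2 (has_mean_intro (iU k (leqnn k))))
  (has_meanZ (2 * D ^+ 2) (has_mean_intro ig)).
case: h => h _; apply: integrable_dom h _.
  by apply: adapted_measurable; apply: enorm2_adapted; exact: drift_adapted.
move=> w; rewrite ger0_norm ?sqr_ge0//.
have hf := f_growth k w.
have e : enorm (drift k w) ^+ 2 <= 2 * U k w + 2 * (D ^+ 2 * enorm (fk k w) ^+ 2).
  rewrite -enorm2Z /U /drift; move: (y k w) (D *: fk k w) => u v.
  have := enorm2_ge0 (u - v); rewrite -[- v]scaleN1r !enorm2D dotvZr enorm2Z; lra.
apply: (le_trans e); rewrite lerD2l -mulrA ler_wpM2l// ler_wpM2l//.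
exact: sqr_ge0.
Qed.

(** By induction: the coefficients grow at most linearly in y 0, ..., y k, and the
    noise is independent of them with finite variance. *)
Lemma EM_square_integrable k :
  P.-integrable setT (EFin \o (fun w => enorm (y k w) ^+ 2)).
Proof.
suff h j : (j <= k)%N -> P.-integrable setT (EFin \o U j) by exact: h (leqnn k).
elim: k j => [|k IH] j.
  rewrite leqn0 => /eqP ->.
  rewrite (_ : U 0%N = fun=> enorm x0 ^+ 2); first by case: (has_mean_cst P (enorm x0 ^+ 2)).
  by apply/funext => w; rewrite /U; have [-> _] := em w.
rewrite leq_eqVlt => /predU1P[->|]; last exact: IH.
have ig : P.-integrable setT (EFin \o (fun w => enorm (gk k w) ^+ 2)).
  apply: integrable_dom (integrable_growth IH) _.
    by apply: adapted_measurable; apply: enorm2_adapted; exact: g_adapted.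
  by move=> w; rewrite ger0_norm ?sqr_ge0.
have [m [im _] _] := noise_step usual brownian (kD_ge0 k) (kD_lt k)
  (fun a => @drift_adapted k a ord0) (@g_adapted k) (integrable_drift IH) ig.
apply: eq_integrable im => // w _ /=; by rewrite /U yS.
Qed.

Let U_int k : P.-integrable setT (EFin \o U k).
Proof. exact: EM_square_integrable. Qed.

(** Multiplying the drift and the diffusion by the indicator of A keeps them known
    at time k, so [noise_step] applies to the event A. *)
Let U_step k (A : set Omega) : F k A ->
  \int[P]_x (\1_A x * U k.+1 x) <= EM_contraction * \int[P]_x (\1_A x * U k x)
    + \sum_(j < k.+1) EM_delay_coef k j * \int[P]_x (\1_A x * U j x).
Proof.
move=> FA; have mA := F_meas FA.
have ind_sq (w : Omega) : (\1_A w : R) ^+ 2 = \1_A w.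
  by rewrite indicE; case: (_ \in _); rewrite ?expr1n ?expr0n.
have mean_ind j : has_mean P (fun x => \1_A x * U j x) (\int[P]_x (\1_A x * U j x)).
  by apply: has_mean_intro; exact: integrable_indicM.
have ig : P.-integrable setT (EFin \o (fun w => enorm (gk k w) ^+ 2)).
  apply: integrable_dom (integrable_growth (fun j _ => U_int j)) _.
    by apply: adapted_measurable; apply: enorm2_adapted; exact: g_adapted.
  by move=> w; rewrite ger0_norm ?sqr_ge0.
have id := integrable_drift (fun j (_ : (j <= k)%N) => U_int j).
pose X w := (\1_A w : R) *: drift k w.
pose G w := (\1_A w : R) *: gk k w.
have XE w : enorm (X w) ^+ 2 = \1_A w * enorm (drift k w) ^+ 2.
  by rewrite /X enorm2Z ind_sq.
have GE w : enorm (G w) ^+ 2 = \1_A w * enorm (gk k w) ^+ 2.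
  by rewrite /G enorm2Z ind_sq.
have iX : P.-integrable setT (EFin \o (fun w => enorm (X w) ^+ 2)).
  by apply: eq_integrable (integrable_indicM mA id) => // w _ /=; rewrite XE.
have iG : P.-integrable setT (EFin \o (fun w => enorm (G w) ^+ 2)).
  by apply: eq_integrable (integrable_indicM mA ig) => // w _ /=; rewrite GE.
have m1 : measurable_wrt (F k) (\1_A : Omega -> R) by exact: measurable_wrt_indic.
have mX a : measurable_wrt (F k) (fun w => X w a ord0).
  rewrite (_ : (fun w => _) = fun w => \1_A w * drift k w a ord0).
    by apply: measurable_funM; [exact: m1|exact: drift_adapted].
  by apply/funext => w; rewrite mxE.
have mG a i : measurable_wrt (F k) (fun w => G w a i).
  rewrite (_ : (fun w => _) = fun w => \1_A w * gk k w a i).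
    by apply: measurable_funM; [exact: m1|exact: g_adapted].
  by apply/funext => w; rewrite mxE.
have [m hm mle] := noise_step usual brownian (kD_ge0 k) (kD_lt k) mX mG iX iG.
have -> : \int[P]_x (\1_A x * U k.+1 x) = m.
  apply: has_mean_uniq (mean_ind k.+1) _; apply: has_mean_ext hm => w.
  by rewrite /X /G -scalemxAl -scalerDr enorm2Z ind_sq /U yS.
apply: (le_trans mle).
have -> : k.+1%:R * D - k%:R * D = D by rewrite -mulrBl -natr1; ring.
have hl := has_meanD (has_mean_intro iX) (has_meanZ D (has_mean_intro iG)).
have hr := has_meanD (has_meanZ EM_contraction (mean_ind k))
  (has_mean_sum (index_enum 'I_k.+1) xpredT
    (fun j : 'I_k.+1 => has_meanZ (EM_delay_coef k j) (mean_ind j))).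
apply: has_mean_le hl hr _ => w.
rewrite XE GE [D * _]mulrCA -mulrDr [EM_contraction * _]mulrCA.
have -> : \sum_(j < k.+1) EM_delay_coef k j * (\1_A w * U j w)
    = \1_A w * \sum_(j < k.+1) EM_delay_coef k j * U j w.
  by rewrite mulr_sumr; apply: eq_bigr => j _; rewrite mulrCA.
rewrite -mulrDr ler_wpM2l ?indicE//.
have -> : \sum_(j < k.+1) EM_delay_coef k j * U j w
    = D * (l2 * \sum_(j < k.+1) c1 k j * U j w)
    + D ^+ 2 * (l4 * \sum_(j < k.+1) c2 k j * U j w).
  rewrite !mulr_sumr -big_split/=; apply: eq_bigr => j _.
  by rewrite /EM_delay_coef; ring.
rewrite /drift enorm2D dotvZr enorm2Z /EM_contraction -/(U k w).
have hd := ler_wpM2l (ltW D_gt0) (f_dissipative k w).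
have hg := ler_wpM2l (sqr_ge0 D) (f_growth k w).
rewrite /growth in hg; lra.
Qed.

Section weighted.
Variables (z : R) (L : nat).
Hypotheses (z_ge0 : 0 <= z) (L_th : 2 <= L%:R * th).

(** The largest total weight with which one value U j can ever be used: each of at
    most L times contributes at most D l2 + D^2 l4. *)
Definition EM_budget := (D * l2 + D ^+ 2 * l4) * L%:R.

Hypothesis contraction : EM_contraction + EM_budget * th `^ (- z) < 1.

Lemma EM_delay_coef_ge0 k j : 0 <= EM_delay_coef k j.
Proof.
by rewrite /EM_delay_coef addr_ge0// mulr_ge0 ?delay_coef_ge0// mulr_ge0 ?sqr_ge0 ?(ltW D_gt0).
Qed.

Let w (k : nat) : R := k.+1%:R `^ z.
Let gam (j : nat) : R := EM_budget * (j.+1%:R / th + 2) `^ z.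

(** A time i whose delayed window reaches j satisfies th i < j + 1, hence
    i + 2 <= (j + 1) / th + 2, which bounds its weight. *)
Lemma EM_delay_coef_column K j N :
  \sum_(K <= i < N) w i.+1 * EM_delay_coef i j <= gam j.
Proof.
have col (m : probability (measurableTypeR R) R) :
    \sum_(K <= i < N) w i.+1 * delay_coef m th thb i j
    <= L%:R * (j.+1%:R / th + 2) `^ z.
  apply: delay_coef_column => //; [exact: powR_ge0|by move=> i; exact: powR_ge0|].
  move=> i ij; apply: ge0_ler_powR => //; rewrite ?nnegrE ?ler0n//.
    by rewrite addr_ge0// divr_ge0.
  have : i%:R <= j.+1%:R / th by rewrite ler_pdivlMr// mulrC -natr1 ltW.
  by rewrite -[i.+2]addn2 natrD; lra.
have -> : \sum_(K <= i < N) w i.+1 * EM_delay_coef i j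
    = D * l2 * \sum_(K <= i < N) w i.+1 * c1 i j
    + D ^+ 2 * l4 * \sum_(K <= i < N) w i.+1 * c2 i j.
  rewrite !mulr_sumr -big_split/=; apply: eq_bigr => i _.
  by rewrite /EM_delay_coef; ring.
have -> : gam j = D * l2 * (L%:R * (j.+1%:R / th + 2) `^ z)
    + D ^+ 2 * l4 * (L%:R * (j.+1%:R / th + 2) `^ z).
  by rewrite /gam /EM_budget; ring.
apply: lerD; apply: ler_wpM2l (col _).
  by rewrite mulr_ge0// ltW.
by rewrite mulr_ge0 ?sqr_ge0.
Qed.

Lemma EM_weighted_bounds : exists K : nat,
  (exists C, forall k, (K <= k)%N -> w k * \int[P]_x (enorm (y k x) ^+ 2) <= C) /\
  {ae P, forall x, exists C, forall k, (K <= k)%N -> w k * enorm (y k x) ^+ 2 <= C}.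
Proof.
have [K HK] := weights_eventually th_gt0 contraction.
have w0 k : 0 <= w k by exact: powR_ge0.
have col := EM_delay_coef_column K.
have mono k : F k `<=` F k.+1 by exact: F_mono_le.
have U0 k x : 0 <= U k x by exact: sqr_ge0.
exists K; split.
  exact: (lyapunov_mean_bounded w0 EM_delay_coef_ge0 HK col F_sigma F_meas U0 U_int U_step).
exact: (lyapunov_bounded_ae w0 EM_delay_coef_ge0 HK col F_sigma F_meas mono U0
  U_adapted U_int U_step).
Qed.

End weighted.

End scheme.

(** * The decay rates *)

Theorem theorem4p3
  (R : realType) (disp : measure_display) (Omega : measurableType disp)
  (P : probability Omega R) (Fil : R -> set (set Omega))
  (n d : nat) (B : R -> Omega -> 'cV[R]_d)
  (Pcomplete : measure_is_complete P)
  (Fil_usual : usual_filtration P Fil)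
  (B_brownian : brownian_motion P Fil B)
  (th thb : R) (th_gt0 : 0 < th) (th_lt1 : th < 1)
  (thb_gt : Num.max (1 / 2) th < thb) (thb_lt1 : thb < 1)
  (f : Cseg th n -> R -> 'cV[R]_n) (g : Cseg th n -> R -> 'M[R]_(n, d))
  (f0 : forall t : R, 0 <= t -> f (Cseg0 th n) t = 0)
  (g0 : forall t : R, 0 <= t -> g (Cseg0 th n) t = 0)
  (x0 : 'cV[R]_n)
  (l1 l2 l3 l4 : R)
  (l1_gt0 : 0 < l1) (l2_gt0 : 0 < l2) (l3_gt0 : 0 < l3) (l4_gt0 : 0 < l4)
  (hyp_a : exists nu : probability (measurableTypeR R) R,
     nu `[th, thb]%classic = 1%E /\
     forall (phi psi : Cseg th n) (t : R), 0 <= t ->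
       2 * dotv (ev phi 1 - ev psi 1) (f phi t - f psi t)
         + enorm (g phi t - g psi t) ^+ 2
       <= - l1 * enorm (ev phi 1 - ev psi 1) ^+ 2
          + l2 * \int[nu]_(u in `[th, thb]%classic) (enorm (ev phi u - ev psi u) ^+ 2))
  (hyp_b : exists nu : probability (measurableTypeR R) R,
     nu `[th, thb]%classic = 1%E /\
     forall (phi psi : Cseg th n) (t : R), 0 <= t ->
       Num.max (enorm (f phi t - f psi t) ^+ 2)
               (enorm (g phi t - g psi t) ^+ 2)
       <= l3 * enorm (ev phi 1 - ev psi 1) ^+ 2
          + l4 * \int[nu]_(u in `[th, thb]%classic) (enorm (ev phi u - ev psi u) ^+ 2))
  (hyp_l : 0 < l1 - 2 * l2 * ((Num.floor (1 / th))%:~R + 1))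
  (zs : R) (zs_gt0 : 0 < zs)
  (zs_root : l1 - zs =
     2 * l2 * ((Num.floor (1 / th))%:~R + 1) * th `^ (- zs)) :
  forall e : R, 0 < e -> e < zs / 2 ->
  exists Ds : R, [/\ 0 < Ds, Ds < 1 &
  forall D : R, 0 < D -> D < Ds ->
  (l2 * ((Num.floor (1 / th))%:~R + 1) * th `^ (- zs - 1)
    + l4 * ((Num.floor (1 / th))%:~R + 1) * th `^ (- zs - 1) * D) * D < 1 / 2 ->
  forall y : nat -> Omega -> 'cV[R]_n, EM_scheme f g x0 B D y ->
    {ae P, forall w,
       (limn_esup (fun k : nat =>
          lne (enorm (y k w))%:E / (ln `|k.+1%:R * D|)%:E)
        <= (- (zs / 2) + e)%:E)%E} /\
    (limn_esup (fun k : nat =>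
        lne 'E_P[fun w => (enorm (y k w) ^+ 2)%R] / (ln `|k.+1%:R * D|)%:E)
     <= (- zs + 2 * e)%:E)%E].
Proof.
move: hyp_a hyp_b => [nu [_ dissipative]] [nu' [_ lipschitz]] e e0 _.
have th_thb : th <= thb by apply: ltW; apply: le_lt_trans thb_gt; rewrite le_max lexx orbT.
(* L bounds the number of times at which one value is used by the delay *)
pose L : nat := (2 * (Num.truncn (1 / th)).+1)%N.
pose T := th `^ (- zs).
have T0 : 0 <= T by exact: powR_ge0.
have th1 : 0 <= 1 / th by rewrite divr_ge0// ltW.
have LE : L%:R = 2 * ((Num.floor (1 / th))%:~R + 1) :> R.
  rewrite /L natrM; congr (_ * _); rewrite -natr1; congr (_ + _).
  by rewrite truncn_floor th1 natr_absz ger0_norm// floor_ge0.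
have L_th : 2 <= L%:R * th.
  have := truncnS_gt (1 / th); rewrite ltr_pdivrMr// => h.
  by rewrite /L natrM -mulrA; lra.
(* the equation for zs says that l1 exceeds the delayed feedback by exactly zs *)
have root : l1 - zs = l2 * L%:R * T by rewrite zs_root LE /T; ring.
pose Q := l3 + l4 * L%:R * T.
have Q0 : 0 < Q by rewrite ltr_wpDr// !mulr_ge0// ltW.
(* D Q collects the terms of second order in the step; D < zs / Q keeps them below zs *)
exists (Num.min (1 / 2) (zs / Q)); split.
- by rewrite lt_min !divr_gt0.
- by rewrite gt_min; apply/orP; left; lra.
move=> D D0 + _ y em; rewrite lt_min => /andP[_]; rewrite ltr_pdivlMr// => DQ.
have contraction : EM_contraction l1 l3 D + EM_budget l2 l4 D L * T < 1.
  have -> : EM_contraction l1 l3 D + EM_budget l2 l4 D L * T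
      = 1 - D * (l1 - l2 * L%:R * T - D * Q).
    by rewrite /EM_contraction /EM_budget /Q; ring.
  rewrite -root gtrBl mulr_gt0//; lra.
have [K [[C meanC] aeC]] := EM_weighted_bounds Fil_usual B_brownian th_gt0 th_thb
  (ltW thb_lt1) f0 g0 (ltW l2_gt0) (ltW l3_gt0) (ltW l4_gt0) dissipative lipschitz
  D0 em (ltW zs_gt0) L_th contraction.
split.
- apply: filterS aeC => w [Cw hCw].
  apply: (@limn_esup_rate _ _ _ _ _ (Num.sqrt Cw) K) => //.
    by move=> k; exact: sqrtr_ge0.
  move=> k Kk; have y0 : 0 <= enorm (y k w) by exact: sqrtr_ge0.
  rewrite -[leLHS]ger0_norm ?mulr_ge0 ?powR_ge0// -sqrtr_sqr exprMn.
  rewrite -powR_mulrn ?powR_ge0// -powRrM.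
  rewrite (_ : zs / 2 * 2%:R = zs); last by field.
  apply: ler_wsqrtr; exact: hCw.
- rewrite (_ : (fun k : nat => _) = (fun k : nat =>
    (lne (\int[P]_w (enorm (y k w) ^+ 2))%:E / (ln `|k.+1%:R * D|)%:E)%E)).
    apply: (@limn_esup_rate _ _ _ _ _ C K) => //; first by rewrite mulr_gt0.
    by move=> k; apply: Rintegral_ge0 => w _; exact: sqr_ge0.
  apply/funext => k; congr (lne _ / _)%E.
  rewrite unlock /Rintegral fineK//; apply: integrable_fin_num => //.
  exact: (EM_square_integrable Fil_usual B_brownian th_gt0 th_thb
    (ltW thb_lt1) f0 g0 (ltW l3_gt0) (ltW l4_gt0) lipschitz D0 em).
Qed.
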